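(* Let $r$ be a symmetric noncommutative (nc) rational function in $g$ variables (and their adjoints) that is regular at $0$. Then $r$ is plush in a neighborhood of $0$ if and only if there exist a positive integer $h$, a convex nc rational function $f$ in $h$ variables, and an analytic nc rational mapping $q$ from $g$-tuples to $h$-tuples of matrices, such that $r=f\circ q$.
   Context: $M_n(\mathbb C)^g$ is the set of $g$-tuples of complex $n\times n$ matrices. For $B\in M_d(\mathbb C)^g$ and $X\in M_n(\mathbb C)^g$ put $\Lambda_B(X)=\sum_{j=1}^g B_j\otimes X_j$ and $\Lambda_B(X)^*=\sum_j B_j^*\otimes X_j^*$. A signature matrix is $K\in M_d(\mathbb C)$ with $K=K^*$, $K^2=I_d$. All nc rational functions here are regular at $0$, that is, given by descriptor realizations as follows. Symmetric nc rational functions: a symmetric descriptor realization of size $d$ (a positive integer) in $g$ variables is an expression $r(x,x^* )=c^*\bigl(K-\sum_j B_jx_j-\sum_j B_j^*x_j^*\bigr)^{-1}c$ with $K\in M_d(\mathbb C)$ a signature matrix, $B\in M_d(\mathbb C)^g$, $c\in\mathbb C^d$. Its domain consists of the tuples $X\in M_n(\mathbb C)^g$ (any $n$) for which $K\otimes I_n-\Lambda_B(X)-\Lambda_B(X)^*$ is invertible; for such $X$, $\Delta(X)$ denotes the inverse and $r(X,X^* )=(c\otimes I_n)^*\Delta(X)(c\otimes I_n)\in M_n(\mathbb C)$. Two such realizations are equivalent if they agree on the intersection of their domains; a symmetric nc rational function is an equivalence class. The function $f$ is of this type, in $h$ variables. Analytic nc rational mappings: an analytic nc rational function is given by $c^*(J-\Lambda_A(x))^{-1}b$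 with $J\in M_d(\mathbb C)$ invertible, $A\in M_d(\mathbb C)^g$, $b,c\in\mathbb C^d$ (no $x_j^*$), evaluated at $X\in M_n(\mathbb C)^g$ as $(c\otimes I_n)^*(J\otimes I_n-\Lambda_A(X))^{-1}(b\otimes I_n)$ when the inverse exists. An analytic nc rational mapping $q=(q_1,\dots,q_h)$ is an $h$-tuple of these, so $q(X)\in M_n(\mathbb C)^h$. The identity $r=f\circ q$ means $r(X,X^* )=f(q(X),q(X)^* )$. Free ball in $k$ variables: $\mathbb B_\varepsilon=(\mathbb B_\varepsilon(n))_n$, $\mathbb B_\varepsilon(n)=\{X\in M_n(\mathbb C)^k:\sum_{j=1}^k X_j^*X_j\prec\varepsilon^2 I_n\}$. Plush: with $C=c\otimes I_n$, the complex Hessian of $r$ (derivative in $x$ in direction $h$, then in $x^*$ in direction $h^*$, treating $x$ and $x^*$ as independent) is $$r_{x,x^*}(X,X^* )[H,H^*]=C^*\Delta(X)\Lambda_B(H)^*\Delta(X)\Lambda_B(H)\Delta(X)C+C^*\Delta(X)\Lambda_B(H)\Delta(X)\Lambda_B(H)^*\Delta(X)C.$$ $r$ is plush (plurisubharmonic) in a neighborhood of $0$ if there is $\varepsilon>0$ such that $\mathbb B_\varepsilon$ lies in the domain and $r_{x,x^*}(X,X^* )[H,H^*]\succeq0$ for all $n$, $X\in\mathbb B_\varepsilon(n)$, $H\in M_n(\mathbb C)^g$. Convex: $f$ is convex (understood in a neighborhood of $0$) if there is $\varepsilon>0$ such that the free ball $\mathbb B_\varepsilon$ in $h$ variables lies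 in the domain of $f$ and, with $F(X)=f(X,X^* )$, $\frac{F(X)+F(Y)}2-F\left(\frac{X+Y}2\right)\succeq0$ for all $n$ and $X,Y\in\mathbb B_\varepsilon(n)$.
   Formalization: The composition r = f∘q is required to take place where f is convex: q(0) must lie in a free ball around 0 on which f is convex; otherwise f=(1-x-x* )^{-1}, q=2+x gives the non-plush r=-(3+x+x* )^{-1}. *)

(* Defs.v *)
From HB Require Import structures.
From mathcomp Require Import all_boot all_order all_algebra.
From mathcomp Require Import reals.
From mathcomp.real_closed Require Import complex mxtens.

Set Implicit Arguments.
Unset Strict Implicit.
Unset Printing Implicit Defensive.

Import Order.TTheory GRing.Theory Num.Theory.

Local Open Scope ring_scope.
Local Open Scope complex_scope.
Local Open Scope sesquilinear_scope.

(* The order of R[i] is the partial one: 0 <= z means that z is real and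
   nonnegative. Hence a matrix satisfying either condition below is
   automatically Hermitian. *)
Definition psdmx (R : realType) (n : nat) (A : 'M[R[i]]_n) : Prop :=
  forall v : 'cV[R[i]]_n, 0 <= (v ^t* *m A *m v) 0 0.

Definition pdmx (R : realType) (n : nat) (A : 'M[R[i]]_n) : Prop :=
  forall v : 'cV[R[i]]_n, v != 0 -> 0 < (v ^t* *m A *m v) 0 0.

Definition mxtuple (R : realType) (g n : nat) : Type := 'I_g -> 'M[R[i]]_n.

Definition Lambda (R : realType) (g d n : nat)
    (B : mxtuple R g d) (X : mxtuple R g n) : 'M[R[i]]_(d * n) :=
  \sum_(j < g) (B j *t X j).

Definition Lambda_adj (R : realType) (g d n : nat)
    (B : mxtuple R g d) (X : mxtuple R g n) : 'M[R[i]]_(d * n) :=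
  \sum_(j < g) ((B j) ^t* *t (X j) ^t*).

(* The matrix c (x) I_n, whose number of columns 1 * n is cast to n. *)
Definition ampl (R : realType) (d : nat) (c : 'cV[R[i]]_d) (n : nat) :
    'M[R[i]]_(d * n, n) :=
  castmx (erefl (d * n)%N, mul1n n) (c *t (1%:M : 'M[R[i]]_n)).

Definition nc_ball (R : realType) (k : nat) (eps : R) (n : nat)
    (X : mxtuple R k n) : Prop :=
  pdmx (((eps ^+ 2)%:C)%:M - \sum_(j < k) ((X j) ^t* *m X j)).

Definition signature_mx (R : realType) (d : nat) (K : 'M[R[i]]_d) : Prop :=
  K ^t* = K /\ K *m K = 1%:M.

(* A symmetric nc rational function is an equivalence class of the following
   realizations, and is always handled through a representative. Every
   representative is regular on a free ball around 0, and equivalent ones agree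
   on a common ball, so the properties "near 0" below do not depend on the
   choice of the representative. *)
Record sym_realization (R : realType) (g : nat) := SymRealization {
  sym_size : nat;
  sym_size_gt0 : (0 < sym_size)%N;
  sym_K : 'M[R[i]]_sym_size;
  sym_B : mxtuple R g sym_size;
  sym_c : 'cV[R[i]]_sym_size;
  sym_K_signature : signature_mx sym_K
}.

Definition sym_pencil (R : realType) (g : nat) (r : sym_realization R g)
    (n : nat) (X : mxtuple R g n) : 'M[R[i]]_(sym_size r * n) :=
  sym_K r *t 1%:M - Lambda (sym_B r) X - Lambda_adj (sym_B r) X.

Definition sym_dom (R : realType) (g : nat) (r : sym_realization R g)
    (n : nat) (X : mxtuple R g n) : Prop :=
  sym_pencil r X \in unitmx.

Definition sym_Delta (R : realType) (g : nat) (r : sym_realization R g)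
    (n : nat) (X : mxtuple R g n) : 'M[R[i]]_(sym_size r * n) :=
  invmx (sym_pencil r X).

Definition sym_eval (R : realType) (g : nat) (r : sym_realization R g)
    (n : nat) (X : mxtuple R g n) : 'M[R[i]]_n :=
  (ampl (sym_c r) n) ^t* *m sym_Delta r X *m ampl (sym_c r) n.

Record an_realization (R : realType) (g : nat) := AnRealization {
  an_size : nat;
  an_size_gt0 : (0 < an_size)%N;
  an_J : 'M[R[i]]_an_size;
  an_A : mxtuple R g an_size;
  an_b : 'cV[R[i]]_an_size;
  an_c : 'cV[R[i]]_an_size;
  an_J_unit : an_J \in unitmx
}.

Definition an_pencil (R : realType) (g : nat) (q : an_realization R g)
    (n : nat) (X : mxtuple R g n) : 'M[R[i]]_(an_size q * n) :=
  an_J q *t 1%:M - Lambda (an_A q) X.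

Definition an_dom (R : realType) (g : nat) (q : an_realization R g)
    (n : nat) (X : mxtuple R g n) : Prop :=
  an_pencil q X \in unitmx.

Definition an_eval (R : realType) (g : nat) (q : an_realization R g)
    (n : nat) (X : mxtuple R g n) : 'M[R[i]]_n :=
  (ampl (an_c q) n) ^t* *m invmx (an_pencil q X) *m ampl (an_b q) n.

(* The components of a mapping may have realizations of different sizes. *)
Definition an_mapping (R : realType) (g h : nat) : Type :=
  'I_h -> an_realization R g.

Definition map_dom (R : realType) (g h : nat) (q : an_mapping R g h)
    (n : nat) (X : mxtuple R g n) : Prop :=
  forall i : 'I_h, an_dom (q i) X.

Definition map_eval (R : realType) (g h : nat) (q : an_mapping R g h)
    (n : nat) (X : mxtuple R g n) : mxtuple R h n :=
  fun i => an_eval (q i) X.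

Definition complex_hessian (R : realType) (g : nat) (r : sym_realization R g)
    (n : nat) (X H : mxtuple R g n) : 'M[R[i]]_n :=
  let C := ampl (sym_c r) n in
  let D := sym_Delta r X in
  let L := Lambda (sym_B r) H in
  let Ls := Lambda_adj (sym_B r) H in
  C ^t* *m D *m Ls *m D *m L *m D *m C + C ^t* *m D *m L *m D *m Ls *m D *m C.

Definition plush (R : realType) (g : nat) (r : sym_realization R g) : Prop :=
  exists2 eps : R, 0 < eps &
    forall (n : nat) (X : mxtuple R g n), nc_ball eps X ->
      sym_dom r X /\
      forall H : mxtuple R g n, psdmx (complex_hessian r X H).

Definition midpoint (R : realType) (k n : nat) (X Y : mxtuple R k n) :
    mxtuple R k n :=
  fun j => 2%:R^-1 *: (X j + Y j).

(* A function f is convex in a neighborhood of 0 when convex_on eps f holds for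
   some eps > 0; the radius is kept explicit because composing f with q has to
   refer to it. *)
Definition convex_on (R : realType) (k : nat) (eps : R)
    (f : sym_realization R k) : Prop :=
  (forall (n : nat) (X : mxtuple R k n), nc_ball eps X -> sym_dom f X) /\
  (forall (n : nat) (X Y : mxtuple R k n), nc_ball eps X -> nc_ball eps Y ->
     psdmx (2%:R^-1 *: (sym_eval f X + sym_eval f Y)
            - sym_eval f (midpoint X Y))).

(* Identity of nc rational functions: agreement on the common domain. *)
Definition nc_comp_eq (R : realType) (g h : nat) (r : sym_realization R g)
    (f : sym_realization R h) (q : an_mapping R g h) : Prop :=
  forall (n : nat) (X : mxtuple R g n),
    sym_dom r X -> map_dom q X -> sym_dom f (map_eval q X) ->
    sym_eval r X = sym_eval f (map_eval q X).

(* The point q(0), as a tuple of 1 x 1 matrices; 0 is always in the domain of q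
   since the matrices J are invertible. *)
Definition map_at0 (R : realType) (g h : nat) (q : an_mapping R g h) :
    mxtuple R h 1 :=
  map_eval q (fun _ : 'I_g => (0 : 'M[R[i]]_1)).

(* Main.v *)
(* Testing a positive complex Hessian on block matrices shows that [K] is
   positive semidefinite on the images of the reachable space under the [B_j],
   and on its images under the adjoints [B_j']; the reachable space is spanned
   by all words in the [K B_j] and [K B_j'] applied to [K c]. Let [N] be [K]
   compressed to the nondegenerate part of that space and let
   [L = Lambda_B(x)]. Then [Q = (1 - N L)^-1 N - N] is analytic in [x], and
     [1 - N L - N L' = (1 - N L) (1 - (1 - N L)^-1 N L N L' (1 - N L')^-1) (1 - N L')].
   By positivity, [N] may be replaced by [F2' F2] between [L] and [L'], and by
   [F1' F1] between [L'] and [L]. Expanding the inverse gives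
     [r = const + a + a' + z' (1 - S)^-1 z], [z = (u, w')], [S = (0 s; s' 0)],
   where [(a w; u s) = (c F1')' Q (c F2')] is analytic in [x]. The right-hand
   side is convex in [(a, u, w, s)], being a supremum of affine functions.

   Conversely, let [X_k = X + i^k t H] for [k < 4]. By convexity the average of
   the [f (q X_k) = r X_k], which is [r X + t^2 hess + O(t^3)], dominates the
   value of [f] at the average of the [q X_k], which is [f (q X) + O(t^3)].
   Hence the complex Hessian is positive. *)
Require Import Defs.
From mathcomp Require Import all_boot all_order all_algebra.
From mathcomp Require Import reals.
From mathcomp.real_closed Require Import complex mxtens.
From mathcomp.classical Require Import boolp.
From mathcomp Require Import ring lra.

Set Implicit Arguments.
Unset Strict Implicit.
Unset Printing Implicit Defensive.

Import Order.TTheory GRing.Theory Num.Theory.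
Local Open Scope ring_scope.
Local Open Scope complex_scope.
Local Open Scope sesquilinear_scope.

(** * Adjoints, vectors and operator bounds *)

(** Positivity of the Hessian speaks only of vectors [Delta(X) (c (x) v)] attained at points [X] of
    a ball, not of formal words, and it has to be tested on the whole reachable space at once. Both
    needs are met by one solution [Y] of maximal rank: a direct sum of two points is again a point,
    so the columns of [Y] span every attained vector, and invariance of this span follows from small
    off-diagonal perturbations of the point.

    [K] is indefinite, so its form may degenerate on that span. [N] is therefore built from a
    Hermitian generalized inverse of the Gram matrix [Y' K Y]; what it discards is invisible to [c]
    and to the [N B_j].

    The identity [r = f o q] is required on the whole common domain, where a Neumann series need not
    converge. Hence the inverse is never expanded: a solution of the pencil equation of [r] is
    turned into a solution of that of [f].

    A ball contains matrices of every size [n]. Bounds that define a radius must be uniform in [n],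
    whereas the remainders [O(t^3)] are used at fixed [X] and [H] and may depend on everything. *)

Definition adj (R : realType) m n (A : 'M[R[i]]_(m, n)) : 'M[R[i]]_(n, m) := A^t*.
Notation "A ^h" := (adj A) (at level 8, format "A ^h") : ring_scope.

Section Adjoint.
Variable R : realType.
Local Notation C := R[i].

Lemma adjE m n (A : 'M[C]_(m, n)) i j : A^h i j = conjc (A j i).
Proof. by rewrite !mxE. Qed.

Lemma adjK m n (A : 'M[C]_(m, n)) : A^h^h = A.
Proof. exact: trmxCK. Qed.

Lemma adjM m n p (A : 'M[C]_(m, n)) (B : 'M[C]_(n, p)) :
  (A *m B)^h = B^h *m A^h.
Proof. by rewrite /adj trmx_mul map_mxM. Qed.

Lemma adjD m n (A B : 'M[C]_(m, n)) : (A + B)^h = A^h + B^h.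
Proof. by rewrite /adj linearD map_mxD. Qed.

Lemma adjN m n (A : 'M[C]_(m, n)) : (- A)^h = - A^h.
Proof. by rewrite /adj linearN map_mxN. Qed.

Lemma adjB m n (A B : 'M[C]_(m, n)) : (A - B)^h = A^h - B^h.
Proof. by rewrite adjD adjN. Qed.

Lemma adjZ m n (a : C) (A : 'M[C]_(m, n)) : (a *: A)^h = a^* *: A^h.
Proof. by rewrite /adj linearZ map_mxZ. Qed.

Lemma adj0 m n : (0 : 'M[C]_(m, n))^h = 0.
Proof. by rewrite /adj trmx0 map_mx0. Qed.

Lemma adj1 n : (1%:M : 'M[C]_n)^h = 1%:M.
Proof. by rewrite /adj trmx1 map_mx1. Qed.

Lemma adj_sum (I : finType) m n (F : I -> 'M[C]_(m, n)) :
  (\sum_i F i)^h = \sum_i (F i)^h.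
Proof. exact: (big_morph _ (@adjD _ _) (adj0 _ _)). Qed.

Lemma adj_tens m n p q (A : 'M[C]_(m, n)) (B : 'M[C]_(p, q)) :
  (A *t B)^h = A^h *t B^h.
Proof. by rewrite /adj trmx_tens map_mxT. Qed.

Lemma adj_inv n (A : 'M[C]_n) : (invmx A)^h = invmx (A^h).
Proof. by rewrite /adj trmx_inv map_invmx. Qed.

Lemma adj_unit n (A : 'M[C]_n) : (A^h \in unitmx) = (A \in unitmx).
Proof. by rewrite /adj map_unitmx unitmx_tr. Qed.

End Adjoint.

Lemma dotmx_triangle (F : numClosedFieldType) n (u v : 'rV[F]_n) :
  sqrtC (dotmx (u + v) (u + v)) <= sqrtC (dotmx u u) + sqrtC (dotmx v v).
Proof. exact: (triangle_lerif (@dotmx F n) u v).1. Qed.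

Lemma dotmx_CauchySchwarz (F : numClosedFieldType) n (u v : 'rV[F]_n) :
  `|dotmx u v| <= sqrtC (dotmx u u) * sqrtC (dotmx v v).
Proof. exact: (CauchySchwarz_sqrt (@dotmx F n) u v).1. Qed.

Lemma unitmx_inj (F : fieldType) n (A : 'M[F]_n) :
  (forall v : 'cV_n, A *m v = 0 -> v = 0) -> A \in unitmx.
Proof.
move=> h; rewrite -unitmx_tr -row_free_unit -kermx_eq0; apply/eqP/row_matrixP => i.
rewrite row0; apply: trmx_inj; rewrite trmx0; apply: h; apply: trmx_inj.
by rewrite trmx_mul trmxK -row_mul mulmx_ker row0 trmx0.
Qed.

Section Norm.
Variable R : realType.
Local Notation normc := (@ComplexField.Normc.normc R).
Local Notation C := R[i].

Definition dotv n (u v : 'cV[C]_n) : C := (u^h *m v) 0 0.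

Lemma dotvE n (u v : 'cV[C]_n) : dotv u v = dotmx v^T u^T.
Proof.
rewrite dotmxE trmxK /dotv /adj !mxE; apply: eq_bigr => i _.
by rewrite !mxE mulrC.
Qed.

Lemma dotvDl n (u v w : 'cV[C]_n) : dotv (u + v) w = dotv u w + dotv v w.
Proof. by rewrite /dotv adjD mulmxDl mxE. Qed.
Lemma dotvDr n (u v w : 'cV[C]_n) : dotv u (v + w) = dotv u v + dotv u w.
Proof. by rewrite /dotv mulmxDr mxE. Qed.
Lemma dotvNl n (u v : 'cV[C]_n) : dotv (- u) v = - dotv u v.
Proof. by rewrite /dotv adjN mulNmx mxE. Qed.
Lemma dotvNr n (u v : 'cV[C]_n) : dotv u (- v) = - dotv u v.
Proof. by rewrite /dotv mulmxN mxE. Qed.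
Lemma dotvBr n (u v w : 'cV[C]_n) : dotv u (v - w) = dotv u v - dotv u w.
Proof. by rewrite dotvDr dotvNr. Qed.
Lemma dotvBl n (u v w : 'cV[C]_n) : dotv (u - v) w = dotv u w - dotv v w.
Proof. by rewrite dotvDl dotvNl. Qed.
Lemma dotvZl n a (u v : 'cV[C]_n) : dotv (a *: u) v = a^* * dotv u v.
Proof. by rewrite /dotv adjZ -scalemxAl mxE. Qed.
Lemma dotvZr n a (u v : 'cV[C]_n) : dotv u (a *: v) = a * dotv u v.
Proof. by rewrite /dotv -scalemxAr mxE. Qed.
Lemma dotv0l n (u : 'cV[C]_n) : dotv 0 u = 0.
Proof. by rewrite /dotv adj0 mul0mx mxE. Qed.
Lemma dotv0r n (u : 'cV[C]_n) : dotv u 0 = 0.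
Proof. by rewrite /dotv mulmx0 mxE. Qed.
Lemma dotv_conj n (u v : 'cV[C]_n) : (dotv u v)^* = dotv v u.
Proof.
have -> : dotv v u = ((u^h *m v)^h) 0 0 by rewrite adjM adjK.
by rewrite adjE.
Qed.
Lemma dotv_adjr m n (A : 'M[C]_(m, n)) u v : dotv u (A *m v) = dotv (A^h *m u) v.
Proof. by rewrite /dotv adjM adjK mulmxA. Qed.
Lemma dotv_adjl m n (A : 'M[C]_(m, n)) u v : dotv (A *m v) u = dotv v (A^h *m u).
Proof. by rewrite /dotv adjM mulmxA. Qed.
Lemma dotv_sumr n (I : finType) (u : 'cV[C]_n) (F : I -> 'cV[C]_n) :
  dotv u (\sum_i F i) = \sum_i dotv u (F i).
Proof. by rewrite /dotv mulmx_sumr summxE. Qed.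

Lemma dotv_ge0 n (u : 'cV[C]_n) : 0 <= dotv u u.
Proof. by rewrite dotvE; exact: dnorm_ge0. Qed.

Lemma dotv_eq0 n (u : 'cV[C]_n) : (dotv u u == 0) = (u == 0).
Proof.
rewrite dotvE dnorm_eq0; apply/eqP/eqP => [|->]; last exact: trmx0.
by move/(congr1 trmx); rewrite trmxK trmx0.
Qed.

Local Notation cRe := (@complex.Re R).

Definition nrm n (v : 'cV[C]_n) : R := cRe (sqrtC (dotv v v)).

Lemma nrmE n (v : 'cV[C]_n) : (nrm v)%:C = sqrtC (dotv v v).
Proof. by rewrite RRe_real // ger0_real // sqrtC_ge0 dotv_ge0. Qed.

Lemma sqr_nrm n (v : 'cV[C]_n) : (nrm v ^+ 2)%:C = dotv v v.
Proof. by rewrite rmorphXn /= nrmE sqrtCK. Qed.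

Lemma nrm_ge0 n (v : 'cV[C]_n) : 0 <= nrm v.
Proof. by rewrite -lecR nrmE sqrtC_ge0 dotv_ge0. Qed.
Hint Resolve nrm_ge0 : core.

Lemma nrm_eq0 n (v : 'cV[C]_n) : (nrm v == 0) = (v == 0).
Proof.
rewrite -(inj_eq (@complexI R)) nrmE sqrtC_eq0; exact: dotv_eq0.
Qed.

Lemma nrm0 n : nrm (0 : 'cV[C]_n) = 0.
Proof. by apply/eqP; rewrite nrm_eq0. Qed.

Lemma nrmD n (u v : 'cV[C]_n) : nrm (u + v) <= nrm u + nrm v.
Proof.
rewrite -lecR rmorphD /= !nrmE !dotvE linearD.
exact: dotmx_triangle.
Qed.

Lemma nrmZ n a (u : 'cV[C]_n) : nrm (a *: u) = normc a * nrm u.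
Proof.
apply: complexI; rewrite rmorphM /= !nrmE dotvZl dotvZr mulrA.
by rewrite sqrtCM ?nnegrE ?dotv_ge0 ?(mulrC a^*) ?mul_conjC_ge0 // -normCK sqrCK // ?normr_ge0.
Qed.

Lemma nrmN n (u : 'cV[C]_n) : nrm (- u) = nrm u.
Proof. by rewrite /nrm dotvNl dotvNr opprK. Qed.

Lemma normc_ge0 (z : C) : 0 <= normc z.
Proof. by rewrite -lecR; exact: (normr_ge0 z). Qed.
Hint Resolve normc_ge0 : core.

Lemma dotv_CauchySchwarz n (u v : 'cV[C]_n) : normc (dotv u v) <= nrm u * nrm v.
Proof.
rewrite -lecR rmorphM /= !nrmE !dotvE mulrC.
exact: dotmx_CauchySchwarz.
Qed.

Lemma Re_le_normc (z : C) : cRe z <= normc z.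
Proof.
apply: le_trans (ler_norm _) _.
rewrite -lecR; exact: normc_ge_Re.
Qed.

(** Only upper bounds occur, so the operator norm is a relation and no supremum is formed. The
    clause [0 <= b] is not automatic: for [n = 0] every [b] satisfies the other one. *)
Definition opnorm_le m n (A : 'M[C]_(m, n)) (b : R) : Prop :=
  0 <= b /\ forall v, nrm (A *m v) <= b * nrm v.

Lemma opnorm_le_ge0 m n (A : 'M[C]_(m, n)) b : opnorm_le A b -> 0 <= b.
Proof. by case. Qed.

Lemma opnorm_le_le m n (A : 'M[C]_(m, n)) a b : opnorm_le A a -> a <= b -> opnorm_le A b.
Proof.
move=> [a0 h] ab; split; first exact: le_trans ab.
by move=> v; apply: le_trans (h v) _; rewrite ler_wpM2r.
Qed.

Lemma opnorm_leD m n (A B : 'M[C]_(m, n)) a b : opnorm_le A a -> opnorm_le B b -> opnorm_le (A + B) (a + b).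
Proof.
move=> [a0 ha] [b0 hb]; split; first exact: addr_ge0.
by move=> v; rewrite mulmxDl mulrDl; apply: le_trans (nrmD _ _) _; apply: lerD.
Qed.

Lemma opnorm_leZ m n (A : 'M[C]_(m, n)) a z : opnorm_le A a -> opnorm_le (z *: A) (normc z * a).
Proof.
move=> [a0 ha]; split; first exact: mulr_ge0.
by move=> v; rewrite -scalemxAl nrmZ -mulrA ler_wpM2l.
Qed.

Lemma opnorm_le0 m n : opnorm_le (0 : 'M[C]_(m, n)) 0.
Proof. by split=> // v; rewrite mul0mx nrm0 mul0r. Qed.

Lemma opnorm_le1 n : opnorm_le (1%:M : 'M[C]_n) 1.
Proof. by split=> // v; rewrite mul1mx mul1r. Qed.

Lemma opnorm_leM m n p (A : 'M[C]_(m, n)) (B : 'M[C]_(n, p)) a b :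
  opnorm_le A a -> opnorm_le B b -> opnorm_le (A *m B) (a * b).
Proof.
move=> [a0 ha] [b0 hb]; split; first exact: mulr_ge0.
move=> v; rewrite -mulmxA -mulrA; apply: le_trans (ha _) _.
by rewrite ler_wpM2l.
Qed.

Lemma opnorm_le_sum m n (I : finType) (F : I -> 'M[C]_(m, n)) (b : I -> R) :
  (forall i, opnorm_le (F i) (b i)) -> opnorm_le (\sum_i F i) (\sum_i b i).
Proof.
move=> h; elim/big_rec2: _ => [|i y x _ hi]; first exact: opnorm_le0.
exact: opnorm_leD.
Qed.

(** [|A' v|^2 = <v, A A' v> <= |v| a |A' v|], and one factor cancels. *)
Lemma opnorm_le_adj m n (A : 'M[C]_(m, n)) a : opnorm_le A a -> opnorm_le (A^h) a.
Proof.
move=> [a0 ha]; split=> // v.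
have h : nrm (A^h *m v) ^+ 2 <= (a * nrm v) * nrm (A^h *m v).
  rewrite -lecR sqr_nrm -dotv_adjr.
  rewrite -[dotv _ _]RRe_real; last first.
    by rewrite dotv_adjr ger0_real // dotv_ge0.
  rewrite lecR; apply: le_trans (Re_le_normc _) _; apply: le_trans (dotv_CauchySchwarz _ _) _.
  by rewrite [a * _]mulrC -mulrA ler_wpM2l.
have [->|n0] := eqVneq (nrm (A^h *m v)) 0; first exact: mulr_ge0.
by move: h; rewrite expr2 ler_pM2r // lt_def n0 nrm_ge0.
Qed.

Lemma adj_delta m n i j : (delta_mx i j : 'M[C]_(m, n))^h = delta_mx j i.
Proof. by rewrite /adj trmx_delta map_delta_mx. Qed.

Lemma dotv_delta n (v : 'cV[C]_n) i : dotv (delta_mx i 0) v = v i 0.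
Proof. by rewrite /dotv adj_delta -rowE mxE. Qed.

Lemma nrm_delta n (i : 'I_n) : nrm (delta_mx i 0 : 'cV[C]_n) = 1.
Proof. by rewrite /nrm dotv_delta mxE !eqxx sqrtC1. Qed.

Lemma entry_nrm n (v : 'cV[C]_n) i : normc (v i 0) <= nrm v.
Proof. by rewrite -dotv_delta; apply: le_trans (dotv_CauchySchwarz _ _) _; rewrite nrm_delta mul1r. Qed.

Lemma opnorm_le_delta m n (i : 'I_m) (j : 'I_n) : opnorm_le (delta_mx i j : 'M[C]_(m, n)) 1.
Proof.
split=> // v; rewrite mul1r.
have -> : delta_mx i j *m v = v j 0 *: delta_mx i 0.
  rewrite -(mul_delta_mx (0 : 'I_1)) -mulmxA -rowE.
  by rewrite [row j v]mx11_scalar mxE mul_mx_scalar.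
by rewrite nrmZ nrm_delta mulr1 entry_nrm.
Qed.

Lemma opnorm_le_ex m n (A : 'M[C]_(m, n)) : exists b, opnorm_le A b.
Proof.
exists (\sum_i \sum_j (normc (A i j) * 1)).
rewrite {1}(matrix_sum_delta A).
by do 2![apply: opnorm_le_sum => ?]; apply: opnorm_leZ; exact: opnorm_le_delta.
Qed.

(* A perturbation bound that does not depend on the size of the matrices. *)
Lemma opnorm_le_perturb n (A E : 'M[C]_n) b e :
  A \in unitmx -> opnorm_le (invmx A) b -> opnorm_le E e -> b * e <= 2^-1 ->
  (A - E) \in unitmx /\ opnorm_le (invmx (A - E)) (2 * b).
Proof.
move=> uA [b0 hb] [e0 he] be.
have key v : nrm v <= 2 * b * nrm ((A - E) *m v).
  have h1 : nrm v <= b * nrm (A *m v) by rewrite -{1}[v](mulKmx uA).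
  have h2 : nrm (A *m v) <= nrm ((A - E) *m v) + e * nrm v.
    rewrite -[A in leLHS](subrK E) mulmxDl; apply: le_trans (nrmD _ _) _.
    by rewrite lerD2l.
  have h3 : nrm v <= b * nrm ((A - E) *m v) + 2^-1 * nrm v.
    apply: le_trans h1 _; apply: le_trans (ler_wpM2l b0 h2) _.
    by rewrite mulrDr lerD2l mulrA ler_wpM2r.
  by lra.
have u : (A - E) \in unitmx.
  apply: unitmx_inj => v h; apply/eqP; rewrite -nrm_eq0 eq_le nrm_ge0 andbT.
  by apply: le_trans (key v) _; rewrite h nrm0 mulr0.
split=> //; split=> [|v]; first by lra.
by apply: le_trans (key _) _; rewrite mulKVmx.
Qed.

End Norm.

Lemma big_mxtens (V : nmodType) m n (F : 'I_(m * n) -> V) :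
  \sum_k F k = \sum_i \sum_j F (mxtens_index (i, j)).
Proof.
rewrite pair_big (reindex (@mxtens_index m n)); last first.
  by exists (@mxtens_unindex m n) => k _; rewrite ?mxtens_indexK ?mxtens_unindexK.
by apply: eq_bigr => -[i j] _.
Qed.

(** * Vectorization of matrices *)

Section Vec.
Variable R : realType.
Local Notation C := R[i].
Local Notation normc := (@ComplexField.Normc.normc R).

(** Row-major, in the index order of [*t], so that [A *t X] sends [vec Y] to [vec (A *m Y *m X^T)].
    Every pencil equation thereby becomes an equation between [d x n] matrices, which can be cut
    into blocks along [n]. *)
Definition vec d n (Y : 'M[C]_(d, n)) : 'cV[C]_(d * n) :=
  \col_k Y (mxtens_unindex k).1 (mxtens_unindex k).2.

Definition unvec d n (y : 'cV[C]_(d * n)) : 'M[C]_(d, n) :=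
  \matrix_(i, j) y (mxtens_index (i, j)) 0.

Lemma vecE d n (Y : 'M[C]_(d, n)) i j : vec Y (mxtens_index (i, j)) 0 = Y i j.
Proof. by rewrite mxE mxtens_indexK. Qed.

Lemma vecK d n : cancel (@vec d n) (@unvec d n).
Proof. by move=> Y; apply/matrixP => i j; rewrite mxE vecE. Qed.

Lemma unvecK d n : cancel (@unvec d n) (@vec d n).
Proof.
by move=> y; apply/colP => k; case: (mxtens_indexP k) => i j; rewrite vecE mxE.
Qed.

Lemma vec_inj d n : injective (@vec d n).
Proof. exact: can_inj (@vecK d n). Qed.

Lemma vecD d n (Y Z : 'M[C]_(d, n)) : vec (Y + Z) = vec Y + vec Z.
Proof. by apply/colP => k; rewrite !mxE. Qed.
Lemma vecN d n (Y : 'M[C]_(d, n)) : vec (- Y) = - vec Y.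
Proof. by apply/colP => k; rewrite !mxE. Qed.
Lemma vecZ d n a (Y : 'M[C]_(d, n)) : vec (a *: Y) = a *: vec Y.
Proof. by apply/colP => k; rewrite !mxE. Qed.
Lemma vec0 d n : vec (0 : 'M[C]_(d, n)) = 0.
Proof. by apply/colP => k; rewrite !mxE. Qed.
Lemma vecB d n (Y Z : 'M[C]_(d, n)) : vec (Y - Z) = vec Y - vec Z.
Proof. by rewrite vecD vecN. Qed.
Lemma vec_sum d n (I : finType) (F : I -> 'M[C]_(d, n)) :
  vec (\sum_i F i) = \sum_i vec (F i).
Proof. exact: (big_morph _ (@vecD d n) (vec0 d n)). Qed.

Lemma tens_vec d e n m (A : 'M[C]_(d, e)) (X : 'M[C]_(m, n)) Y :
  (A *t X) *m vec Y = vec (A *m Y *m X^T).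
Proof.
apply/colP => k; case: (mxtens_indexP k) => i j; rewrite vecE !mxE big_mxtens.
under eq_bigr => a _ do under eq_bigr => b _ do rewrite tensmxE vecE.
rewrite exchange_big; apply: eq_bigr => b _; rewrite !mxE big_distrl /=.
by apply: eq_bigr => a _; ring.
Qed.

Lemma dotv_vec d n (Y Z : 'M[C]_(d, n)) : dotv (vec Y) (vec Z) = \tr (Y^h *m Z).
Proof.
rewrite /dotv mxE big_mxtens exchange_big; apply: eq_bigr => j _ /=.
by rewrite mxE; apply: eq_bigr => i _; rewrite !mxE !mxtens_indexK.
Qed.

Lemma dotv_vec_col d n (Y Z : 'M[C]_(d, n)) :
  dotv (vec Y) (vec Z) = \sum_j dotv (col j Y) (col j Z).
Proof.
rewrite dotv_vec; apply: eq_bigr => j _; rewrite /dotv !mxE.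
by apply: eq_bigr => i _; rewrite !mxE.
Qed.

Lemma dotv_vec_row d n (Y Z : 'M[C]_(d, n)) :
  dotv (vec Y) (vec Z) = \sum_i dotv (row i Y)^T (row i Z)^T.
Proof.
rewrite dotv_vec /mxtrace; under eq_bigr => j _ do rewrite mxE.
rewrite exchange_big; apply: eq_bigr => i _; rewrite /dotv !mxE.
by apply: eq_bigr => j _; rewrite !mxE.
Qed.

Lemma sqr_nrm_sum n p (I : finType) (u : 'cV[C]_n) (v : I -> 'cV[C]_p) :
  dotv u u = \sum_i dotv (v i) (v i) -> nrm u ^+ 2 = \sum_i nrm (v i) ^+ 2.
Proof.
move=> h; apply: complexI; rewrite sqr_nrm h rmorph_sum /=.
by apply: eq_bigr => i _; rewrite sqr_nrm.
Qed.

Lemma nrm_le_sum n m p q (I : finType) (u : 'cV[C]_n) (w : 'cV[C]_m)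
    (v : I -> 'cV[C]_p) (v' : I -> 'cV[C]_q) a :
  0 <= a ->
  dotv u u = \sum_i dotv (v i) (v i) -> dotv w w = \sum_i dotv (v' i) (v' i) ->
  (forall i, nrm (v i) <= a * nrm (v' i)) -> nrm u <= a * nrm w.
Proof.
move=> a0 /sqr_nrm_sum hu /sqr_nrm_sum hw h.
rewrite -ler_sqr ?nnegrE ?mulr_ge0 ?nrm_ge0 // exprMn hu hw mulr_sumr.
apply: ler_sum => i _; rewrite -exprMn ler_sqr ?nnegrE ?mulr_ge0 ?nrm_ge0 //.
Qed.

(** [A *t 1] acts on each column of [unvec v] separately, and squared norms add over the columns;
    hence a bound that does not depend on [n]. *)
Lemma opnorm_le_tensl m p n (A : 'M[C]_(m, p)) a :
  opnorm_le A a -> opnorm_le (A *t (1%:M : 'M_n)) a.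
Proof.
move=> [a0 h]; split=> // v; rewrite -[v]unvecK tens_vec trmx1 mulmx1.
apply: nrm_le_sum a0 (dotv_vec_col _ _) (dotv_vec_col _ _) _ => i.
by rewrite !colE -mulmxA.
Qed.

Lemma opnorm_le_tensr m n d (X : 'M[C]_(m, n)) a :
  opnorm_le X a -> opnorm_le ((1%:M : 'M_d) *t X) a.
Proof.
move=> [a0 h]; split=> // v; rewrite -[v]unvecK tens_vec mul1mx.
apply: nrm_le_sum a0 (dotv_vec_row _ _) (dotv_vec_row _ _) _ => i.
by rewrite row_mul trmx_mul trmxK.
Qed.

Lemma opnorm_le_tens m n p q (A : 'M[C]_(m, n)) (X : 'M[C]_(p, q)) a x :
  opnorm_le A a -> opnorm_le X x -> opnorm_le (A *t X) (a * x).
Proof.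
move=> ha hx; have -> : A *t X = (A *t 1%:M) *m (1%:M *t X).
  by rewrite tensmx_mul mulmx1 mul1mx.
by apply: opnorm_leM; [exact: opnorm_le_tensl | exact: opnorm_le_tensr].
Qed.

Lemma amplM d n (c : 'cV[C]_d) (v : 'cV[C]_n) :
  ampl c n *m v = vec (c *m v^T).
Proof.
have -> : ampl c n *m v = (c *t 1%:M) *m castmx (esym (mul1n n), erefl 1%N) v.
  by rewrite /ampl mulmx_cast castmx_id esymK.
have -> : castmx (esym (mul1n n), erefl 1%N) v = vec v^T.
  apply/colP => k; case: (mxtens_indexP k) => i j; rewrite vecE castmxE mxE /=.
  by congr (v _ _); apply: val_inj; rewrite /= ?ord1 // mul0n add0n.
by rewrite tens_vec trmx1 mulmx1.
Qed.

Lemma ampl_adj d n (c : 'cV[C]_d) (Y : 'M[C]_(d, n)) :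
  (ampl c n)^h *m vec Y = (c^h *m Y)^T.
Proof.
apply/colP => i; rewrite -dotv_delta dotv_adjr adjK amplM dotv_vec mxE.
rewrite trmx_delta adjM adj_delta -mulmxA mxtrace_mulC.
by rewrite trace_mx11 -colE mxE.
Qed.

End Vec.

(** * Realizations as matrix equations *)

Section Pencil.
Variable R : realType.
Local Notation C := R[i].
Local Notation normc := (@ComplexField.Normc.normc R).

Lemma Lambda_adjE g d n (B : mxtuple R g d) (X : mxtuple R g n) :
  Lambda_adj B X = (Lambda B X)^h.
Proof.
by rewrite /Lambda adj_sum; apply: eq_bigr => j _; rewrite adj_tens.
Qed.

Lemma Lambda_vec g d n (B : mxtuple R g d) (X : mxtuple R g n) Y :
  Lambda B X *m vec Y = vec (\sum_j B j *m Y *m (X j)^T).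
Proof.
by rewrite /Lambda mulmx_suml vec_sum; apply: eq_bigr => j _; rewrite tens_vec.
Qed.

Lemma Lambda_adj_vec g d n (B : mxtuple R g d) (X : mxtuple R g n) Y :
  Lambda_adj B X *m vec Y = vec (\sum_j (B j)^h *m Y *m ((X j)^h)^T).
Proof.
by rewrite /Lambda_adj mulmx_suml vec_sum; apply: eq_bigr => j _; rewrite tens_vec.
Qed.

Lemma opnorm_le_Lambda g d (B : mxtuple R g d) : exists2 b : R, 0 < b &
  forall n (X : mxtuple R g n) t, 0 <= t -> (forall j, opnorm_le (X j) t) ->
  opnorm_le (Lambda B X) (b * t).
Proof.
have [b hb] : exists b : 'I_g -> R, forall j, opnorm_le (B j) (b j).
  elim: g B => [|g IH] B; first by exists (fun=> 0) => -[].
  have [b0 h0] := opnorm_le_ex (B ord0); have [b h] := IH (fun j => B (lift ord0 j)).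
  exists (fun j => oapp b b0 (unlift ord0 j)) => j.
  by case: unliftP => [k ->|->] /=.
have b0 j : 0 <= b j by apply: opnorm_le_ge0 (hb j).
(* The summand 1 keeps the constant positive when all [B j] vanish; radii are later obtained by
   inverting it. *)
exists (\sum_j b j + 1); first by rewrite ltr_wpDl // sumr_ge0.
move=> n X t t0 hX; apply: (@opnorm_le_le _ _ _ _ ((\sum_j b j) * t)).
  by rewrite mulr_suml; apply: opnorm_le_sum => j; apply: opnorm_le_tens.
by rewrite ler_wpM2r // lerDl.
Qed.

Lemma tens11 m n : (1%:M : 'M[C]_m) *t (1%:M : 'M[C]_n) = 1%:M.
Proof.
apply/matrixP => i j; case: (mxtens_indexP i) => a b; case: (mxtens_indexP j) => a' b'.
rewrite tensmxE !mxE (can_eq (@mxtens_indexK m n)) xpair_eqE.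
by case: (a == a'); case: (b == b'); rewrite ?mulr1 ?mulr0.
Qed.

Lemma tens1_unit n m (A : 'M[C]_m) : A \in unitmx -> A *t (1%:M : 'M_n) \in unitmx.
Proof.
move=> u; have h : A *t (1%:M : 'M_n) *m (invmx A *t (1%:M : 'M_n)) = 1%:M.
  by rewrite tensmx_mul mulmxV // mulmx1 tens11.
by case: (mulmx1_unit h).
Qed.

Lemma signature_unit d (K : 'M[C]_d) : signature_mx K -> K \in unitmx.
Proof. by case=> _ /mulmx1_unit[]. Qed.

Lemma nc_ballE g n eps (X : mxtuple R g n) v :
  (v^h *m (((eps ^+ 2)%:C)%:M - \sum_(j < g) ((X j)^h *m X j)) *m v) 0 0
  = (eps ^+ 2 * nrm v ^+ 2 - \sum_j nrm (X j *m v) ^+ 2)%:C.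
Proof.
rewrite -mulmxA -/(dotv _ _) mulmxBl dotvBr mul_scalar_mx dotvZr mulmx_suml.
rewrite dotv_sumr -sqr_nrm.
have -> : \sum_j dotv v ((X j)^h *m X j *m v) = (\sum_j nrm (X j *m v) ^+ 2)%:C.
  rewrite rmorph_sum; apply: eq_bigr => j _.
  by rewrite -mulmxA dotv_adjr adjK /= sqr_nrm.
by rewrite rmorphB [in RHS]rmorphM.
Qed.

Lemma nc_ball_opnorm_le g n eps (X : mxtuple R g n) j :
  0 <= eps -> nc_ball eps X -> opnorm_le (X j) eps.
Proof.
move=> e0 h; split=> // v; have [->|v0] := eqVneq v 0.
  by rewrite mulmx0 !nrm0 mulr0.
have := h v v0; rewrite nc_ballE ltcR subr_gt0 => hv.
rewrite -ler_sqr ?nnegrE ?mulr_ge0 ?nrm_ge0 // exprMn.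
apply: le_trans (ltW hv); rewrite (bigD1 j) //= lerDl.
by apply: sumr_ge0 => i _; exact: sqr_ge0.
Qed.

Lemma opnorm_le_nc_ball g n eps (X : mxtuple R g n) (t : 'I_g -> R) :
  (forall j, opnorm_le (X j) (t j)) -> \sum_j t j ^+ 2 < eps ^+ 2 -> nc_ball eps X.
Proof.
move=> h te v v0; rewrite nc_ballE ltcR subr_gt0.
have p : 0 < nrm v ^+ 2 by rewrite exprn_gt0 // lt_def nrm_eq0 v0 nrm_ge0.
apply: le_lt_trans (_ : (\sum_j t j ^+ 2) * nrm v ^+ 2 < _); last by rewrite ltr_pM2r.
rewrite mulr_suml; apply: ler_sum => j _; rewrite -exprMn.
by rewrite ler_sqr ?nnegrE ?mulr_ge0 ?nrm_ge0 ?(opnorm_le_ge0 (h j)) // (h j).2.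
Qed.

Lemma nc_ball_small g eps : 0 < eps -> exists2 t : R, 0 < t &
  forall n (X : mxtuple R g n), (forall j, opnorm_le (X j) t) -> nc_ball eps X.
Proof.
(* [g t^2 < eps^2] for this [t], also when [g = 0]. *)
move=> e0; pose t := eps / (g.+1)%:R.
have t0 : 0 < t by rewrite divr_gt0 // ltr0Sn.
exists t => // n X h; apply: (opnorm_le_nc_ball h).
rewrite sumr_const card_ord -mulr_natl /t expr_div_n mulrA ltr_pdivrMr ?exprn_gt0 ?ltr0Sn //.
rewrite mulrC ltr_pM2l ?exprn_gt0 // -natrX ltr_nat.
by rewrite -mulnn mulSn ltn_addr.
Qed.

Lemma tens1_invE n m (A : 'M[C]_m) : A \in unitmx ->
  invmx (A *t (1%:M : 'M_n)) = invmx A *t 1%:M.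
Proof.
move=> u; apply: (can_inj (mulKmx (tens1_unit n u))).
by rewrite mulmxV ?tens1_unit // tensmx_mul mulmxV // mulmx1 tens11.
Qed.

Lemma opnorm_le_inv1 d (K : 'M[C]_d) : K \in unitmx -> exists b : R, 0 < b /\
  forall n, opnorm_le (invmx (K *t (1%:M : 'M_n))) b.
Proof.
move=> u; have [b hb] := opnorm_le_ex (invmx K); exists (b + 1); split.
  by rewrite ltr_wpDl // (opnorm_le_ge0 hb).
move=> n; rewrite tens1_invE //; apply: opnorm_le_le (opnorm_le_tensl _ hb) _; by rewrite lerDl.
Qed.

Lemma sym_near0 g (r : sym_realization R g) : exists t b : R, [/\ 0 < t, 0 < b &
  forall n (X : mxtuple R g n), (forall j, opnorm_le (X j) t) ->
  sym_dom r X /\ opnorm_le (sym_Delta r X) b].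
Proof.
have uK := signature_unit (sym_K_signature r).
have [b [b0 hb]] := opnorm_le_inv1 uK; have [l l0 hl] := opnorm_le_Lambda (sym_B r).
(* The perturbation [L + L'] has norm at most [2 l t], and its product with [b] may not exceed
   [1/2]. *)
pose t := (4 * b * l)^-1.
have t0 : 0 < t by rewrite invr_gt0 !mulr_gt0.
exists t, (2 * b); split=> [//||n X hX]; first by rewrite mulr_gt0.
have hL := hl n X t (ltW t0) hX.
rewrite /sym_Delta /sym_dom /sym_pencil -addrA -opprD Lambda_adjE.
apply: (opnorm_le_perturb (tens1_unit n uK) (hb n) (opnorm_leD hL (opnorm_le_adj hL))).
rewrite le_eqVlt /t; apply/orP; left; apply/eqP; field.
by rewrite !lt0r_neq0.
Qed.

Lemma an_near0 g (q : an_realization R g) : exists t b : R, [/\ 0 < t, 0 < b &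
  forall n (X : mxtuple R g n), (forall j, opnorm_le (X j) t) ->
  an_dom q X /\ opnorm_le (invmx (an_pencil q X)) b].
Proof.
have [b [b0 hb]] := opnorm_le_inv1 (an_J_unit q); have [l l0 hl] := opnorm_le_Lambda (an_A q).
pose t := (2 * b * l)^-1.
have t0 : 0 < t by rewrite invr_gt0 !mulr_gt0.
exists t, (2 * b); split=> [//||n X hX]; first by rewrite mulr_gt0.
have hL := hl n X t (ltW t0) hX.
apply: (opnorm_le_perturb (tens1_unit n (an_J_unit q)) (hb n) hL).
rewrite le_eqVlt /t; apply/orP; left; apply/eqP; field.
by rewrite !lt0r_neq0.
Qed.

Lemma sym_pencil_vec g (r : sym_realization R g) n (X : mxtuple R g n) Y :
  sym_pencil r X *m vec Y =
  vec (sym_K r *m Y - \sum_j sym_B r j *m Y *m (X j)^T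
       - \sum_j (sym_B r j)^h *m Y *m ((X j)^h)^T).
Proof.
by rewrite /sym_pencil !mulmxBl Lambda_vec Lambda_adj_vec tens_vec trmx1 mulmx1 !vecB.
Qed.

Lemma sym_K_herm g (r : sym_realization R g) : (sym_K r)^h = sym_K r.
Proof. exact: (sym_K_signature r).1. Qed.

Lemma sym_pencil_herm g (r : sym_realization R g) n (X : mxtuple R g n) :
  (sym_pencil r X)^h = sym_pencil r X.
Proof.
rewrite /sym_pencil Lambda_adjE !adjB adjK adj_tens adj1.
by rewrite sym_K_herm addrAC.
Qed.

Lemma sym_Delta_herm g (r : sym_realization R g) n (X : mxtuple R g n) :
  (sym_Delta r X)^h = sym_Delta r X.
Proof. by rewrite /sym_Delta adj_inv sym_pencil_herm. Qed.

(** Values are read off from any solution of the pencil equation, so no inverse has to be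
    computed. *)
Lemma sym_evalE g (r : sym_realization R g) n (X : mxtuple R g n) Y v :
  sym_dom r X -> sym_pencil r X *m vec Y = ampl (sym_c r) n *m v ->
  sym_eval r X *m v = ((sym_c r)^h *m Y)^T.
Proof.
move=> u h; rewrite /sym_eval -!mulmxA -h /sym_Delta mulKmx //.
exact: ampl_adj.
Qed.

Lemma an_evalE g (q : an_realization R g) n (X : mxtuple R g n) Y v :
  an_dom q X -> an_pencil q X *m vec Y = ampl (an_b q) n *m v ->
  an_eval q X *m v = ((an_c q)^h *m Y)^T.
Proof.
by move=> u h; rewrite /an_eval -!mulmxA -h mulKmx // ampl_adj.
Qed.

End Pencil.

(** * The reachable subspace of a plush function *)

Section Blocks.
Variable R : realType.
Local Notation C := R[i].
Local Notation normc := (@ComplexField.Normc.normc R).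

Lemma adj_col_mx m n p (A : 'M[C]_(m, p)) (B : 'M[C]_(n, p)) :
  (col_mx A B)^h = row_mx A^h B^h.
Proof. by rewrite /adj tr_col_mx map_row_mx. Qed.

Lemma adj_row_mx m n p (A : 'M[C]_(p, m)) (B : 'M[C]_(p, n)) :
  (row_mx A B)^h = col_mx A^h B^h.
Proof. by rewrite /adj tr_row_mx map_col_mx. Qed.

Lemma adj_block_mx m n p q (A : 'M[C]_(m, n)) (B : 'M[C]_(m, p)) (D : 'M[C]_(q, n))
    (E : 'M[C]_(q, p)) :
  (block_mx A B D E)^h = block_mx A^h D^h B^h E^h.
Proof. by rewrite /adj tr_block_mx map_block_mx. Qed.

Lemma adj_scalar n (s : R) : ((s%:C)%:M : 'M[C]_n)^h = (s%:C)%:M.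
Proof. by rewrite /adj tr_scalar_mx map_scalar_mx; congr (_%:M); exact: conjc_real. Qed.

Lemma dotv_col_mx m n (u u' : 'cV[C]_m) (w w' : 'cV[C]_n) :
  dotv (col_mx u w) (col_mx u' w') = dotv u u' + dotv w w'.
Proof. by rewrite /dotv adj_col_mx mul_row_col mxE. Qed.

Lemma sqr_nrm_col_mx m n (u : 'cV[C]_m) (w : 'cV[C]_n) :
  nrm (col_mx u w) ^+ 2 = nrm u ^+ 2 + nrm w ^+ 2.
Proof. by apply: complexI; rewrite rmorphD /= !sqr_nrm dotv_col_mx. Qed.

Lemma opnorm_le_block_diag m n p q (A : 'M[C]_(m, n)) (D : 'M[C]_(p, q)) a :
  opnorm_le A a -> opnorm_le D a -> opnorm_le (block_mx A 0 0 D) a.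
Proof.
move=> [a0 hA] [_ hD]; split=> // v; rewrite -[v]vsubmxK mul_block_col !mul0mx addr0 add0r.
rewrite -ler_sqr ?nnegrE ?mulr_ge0 ?nrm_ge0 // exprMn !sqr_nrm_col_mx mulrDr -!exprMn.
by apply: lerD; rewrite ler_sqr ?nnegrE ?mulr_ge0 ?nrm_ge0.
Qed.

Lemma opnorm_le_block_dl m n p q (A : 'M[C]_(p, n)) a :
  opnorm_le A a -> opnorm_le (block_mx (0 : 'M_(m, n)) (0 : 'M_(m, q)) A 0) a.
Proof.
move=> [a0 hA]; split=> // v; rewrite -[v]vsubmxK mul_block_col !mul0mx !addr0.
rewrite -ler_sqr ?nnegrE ?mulr_ge0 ?nrm_ge0 // exprMn !sqr_nrm_col_mx nrm0 expr0n add0r.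
apply: le_trans (_ : (a * nrm (usubmx v)) ^+ 2 <= _).
  by rewrite ler_sqr ?nnegrE ?mulr_ge0 ?nrm_ge0.
by rewrite exprMn ler_wpM2l ?sqr_ge0 // lerDl sqr_ge0.
Qed.

Lemma opnorm_le_block_ur m n p q (A : 'M[C]_(m, p)) a :
  opnorm_le A a -> opnorm_le (block_mx (0 : 'M_(m, n)) A (0 : 'M_(q, n)) 0) a.
Proof.
move=> hA; rewrite -[block_mx _ _ _ _]adjK; apply: opnorm_le_adj.
rewrite adj_block_mx !adj0; apply: opnorm_le_block_dl.
exact: opnorm_le_adj.
Qed.

Lemma dotv_vec_row_mx d m n (Y Y' : 'M[C]_(d, m)) (Z Z' : 'M[C]_(d, n)) :
  dotv (vec (row_mx Y Z)) (vec (row_mx Y' Z')) =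
  dotv (vec Y) (vec Y') + dotv (vec Z) (vec Z').
Proof.
by rewrite !dotv_vec adj_row_mx mul_col_row mxtrace_block.
Qed.

Lemma dotv_vec1 d (w w' : 'cV[C]_d) : dotv (vec w) (vec w') = dotv w w'.
Proof. by rewrite dotv_vec trace_mx11. Qed.

(** The action of [Lambda B X] under [vec]. The [X j] may be rectangular, so that the same operator
    applies to off-diagonal blocks of a tuple. *)
Definition lambda_mx g d m n (B : 'I_g -> 'M[C]_d) (X : 'I_g -> 'M[C]_(m, n))
    (Y : 'M[C]_(d, n)) : 'M[C]_(d, m) :=
  \sum_j B j *m Y *m (X j)^T.

Definition adjt g m n (X : 'I_g -> 'M[C]_(m, n)) : 'I_g -> 'M[C]_(n, m) :=
  fun j => (X j)^h.

Definition blk g m1 m2 n1 n2 (X11 : 'I_g -> 'M[C]_(m1, n1)) (X12 : 'I_g -> 'M[C]_(m1, n2))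
   (X21 : 'I_g -> 'M[C]_(m2, n1)) (X22 : 'I_g -> 'M[C]_(m2, n2)) j :=
  block_mx (X11 j) (X12 j) (X21 j) (X22 j).

Lemma eq_lamX g d m n (B B' : 'I_g -> 'M[C]_d) (X X' : 'I_g -> 'M[C]_(m, n)) Y :
  B =1 B' -> X =1 X' -> lambda_mx B X Y = lambda_mx B' X' Y.
Proof. by move=> hB hX; apply: eq_bigr => j _; rewrite hB hX. Qed.

Lemma adjt_blk g m1 m2 n1 n2 (X11 : 'I_g -> 'M[C]_(m1, n1)) (X12 : 'I_g -> 'M[C]_(m1, n2))
   (X21 : 'I_g -> 'M[C]_(m2, n1)) (X22 : 'I_g -> 'M[C]_(m2, n2)) :
  adjt (blk X11 X12 X21 X22) =1 blk (adjt X11) (adjt X21) (adjt X12) (adjt X22).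
Proof. by move=> j; rewrite /adjt /blk adj_block_mx. Qed.

Lemma sum_row_mx (I : finType) d m n (F : I -> 'M[C]_(d, m)) (G : I -> 'M[C]_(d, n)) :
  \sum_i row_mx (F i) (G i) = row_mx (\sum_i F i) (\sum_i G i).
Proof.
elim/big_rec3: _ => [|i x y z _ ->]; first by rewrite row_mx0.
by rewrite add_row_mx.
Qed.

Lemma lambda_mx_blk g d m1 m2 n1 n2 (B : 'I_g -> 'M[C]_d)
   (X11 : 'I_g -> 'M[C]_(m1, n1)) (X12 : 'I_g -> 'M[C]_(m1, n2))
   (X21 : 'I_g -> 'M[C]_(m2, n1)) (X22 : 'I_g -> 'M[C]_(m2, n2)) Y1 Y2 :
  lambda_mx B (blk X11 X12 X21 X22) (row_mx Y1 Y2) =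
  row_mx (lambda_mx B X11 Y1 + lambda_mx B X12 Y2) (lambda_mx B X21 Y1 + lambda_mx B X22 Y2).
Proof.
rewrite /lambda_mx -!big_split -sum_row_mx; apply: eq_bigr => j _ /=.
by rewrite /blk tr_block_mx mul_mx_row mul_row_block.
Qed.

Lemma lambda_mx0 g d m n (B : 'I_g -> 'M[C]_d) (Y : 'M[C]_(d, n)) :
  lambda_mx B (fun=> 0 : 'M[C]_(m, n)) Y = 0.
Proof. by apply: big1 => j _; rewrite trmx0 mulmx0. Qed.

Lemma lambda_mx0r g d m n (B : 'I_g -> 'M[C]_d) (X : 'I_g -> 'M[C]_(m, n)) : lambda_mx B X 0 = 0.
Proof. by apply: big1 => j _; rewrite mulmx0 mul0mx. Qed.

Definition pencil_mx g (r : sym_realization R g) n (X : mxtuple R g n) Y :=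
  sym_K r *m Y - lambda_mx (sym_B r) X Y - lambda_mx (adjt (sym_B r)) (adjt X) Y.

Arguments pencil_mx {g} r {n} X Y.

Lemma pencil_mxE g (r : sym_realization R g) n (X : mxtuple R g n) Y :
  sym_pencil r X *m vec Y = vec (pencil_mx r X Y).
Proof. exact: sym_pencil_vec. Qed.

Lemma pencil_mx_blk g (r : sym_realization R g) m n (X11 : mxtuple R g m)
   (X12 : 'I_g -> 'M[C]_(m, n)) (X21 : 'I_g -> 'M[C]_(n, m)) (X22 : mxtuple R g n) Y1 Y2 :
  pencil_mx r (blk X11 X12 X21 X22) (row_mx Y1 Y2) =
  row_mx (pencil_mx r X11 Y1 - lambda_mx (sym_B r) X12 Y2 - lambda_mx (adjt (sym_B r)) (adjt X21) Y2)
    (pencil_mx r X22 Y2 - lambda_mx (sym_B r) X21 Y1 - lambda_mx (adjt (sym_B r)) (adjt X12) Y1).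
Proof.
rewrite {1}/pencil_mx (eq_lamX _ (fun=> erefl) (adjt_blk _ _ _ _)) !lambda_mx_blk.
rewrite mul_mx_row !opp_row_mx !add_row_mx /pencil_mx.
congr row_mx; rewrite !opprD !addrA; first by congr (_ - _); exact: addrAC.
by rewrite [RHS](ACl (1*4*2*5*3)).
Qed.

Lemma pencil_mx0 g (r : sym_realization R g) n Y : pencil_mx r (fun=> 0 : 'M_n) Y = sym_K r *m Y.
Proof.
rewrite /pencil_mx lambda_mx0 (eq_lamX (X' := fun=> 0) _ (fun=> erefl)) ?lambda_mx0 ?subr0 //.
by move=> j; rewrite /adjt adj0.
Qed.

End Blocks.
Arguments pencil_mx {R g} r {n} X Y.

(** * The span of the attained vectors *)

Section Reach.
Variable R : realType.
Local Notation C := R[i].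
Local Notation normc := (@ComplexField.Normc.normc R).

Lemma le0_small (x a s0 : R) : 0 < s0 ->
  (forall s, 0 < s -> s < s0 -> x <= a * s) -> x <= 0.
Proof.
move=> s00 h; rewrite leNgt; apply/negP => x0.
have a1 : 0 < 2 * (`|a| + 1) by rewrite mulr_gt0 // ltr_wpDl.
pose s := Num.min (s0 / 2) (x / (2 * (`|a| + 1))).
have sp : 0 < s by rewrite lt_min !divr_gt0.
have ss0 : s < s0 by rewrite gt_min ltr_pdivrMr // ltr_pMr // ltr1n.
have sx : s * (2 * (`|a| + 1)) <= x by rewrite -ler_pdivlMr // ge_min lexx orbT.
have := h s sp ss0; have : a * s <= `|a| * s by rewrite ler_wpM2r ?ler_norm // ltW.
by nra.
Qed.

Lemma dotv_sandwich m n p (A : 'M[C]_(n, m)) (D : 'M[C]_n) (L : 'M[C]_(p, n))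
    (P : 'M[C]_p) v : D^h = D ->
  dotv v (A^h *m D *m L^h *m P *m L *m D *m A *m v) =
  dotv (L *m (D *m A *m v)) (P *m (L *m (D *m A *m v))).
Proof.
move=> hD; have -> : A^h *m D *m L^h = (L *m D *m A)^h by rewrite !adjM hD mulmxA.
rewrite (_ : _ *m v = (L *m D *m A)^h *m (P *m (L *m (D *m A *m v)))).
  by rewrite dotv_adjr adjK !mulmxA.
by rewrite !mulmxA.
Qed.

Lemma complex_hessianE g (r : sym_realization R g) n (X H : mxtuple R g n) v :
  let a := sym_Delta r X *m ampl (sym_c r) n *m v in
  (v^h *m complex_hessian r X H *m v) 0 0 =
  dotv (Lambda (sym_B r) H *m a) (sym_Delta r X *m (Lambda (sym_B r) H *m a)) +
  dotv (Lambda_adj (sym_B r) H *m a) (sym_Delta r X *m (Lambda_adj (sym_B r) H *m a)).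
Proof.
rewrite /= -mulmxA -/(dotv _ _) /complex_hessian mulmxDl dotvDr Lambda_adjE.
have hD := sym_Delta_herm r X.
move: (sym_Delta r X) hD (ampl _ _) (Lambda _ _) => D hD A L.
congr (_ + _); first exact: dotv_sandwich.
have := dotv_sandwich A (L^h) D v hD; rewrite adjK; exact.
Qed.

(** Once [s |M| <= 1/2], the norm of [Z] is at most twice that of [Y], so [Z - Y = O(s)]. As [Q T]
    kills [Z], the norm of [Q T Y] is at most a multiple of [s]. *)
Lemma kernel_limit d n k (Q : 'M[C]_(k, d)) (T : 'M[C]_d) (M : 'M[C]_(d * n))
    (Y : 'M[C]_(d, n)) (s0 : R) :
  0 < s0 ->
  (forall s, 0 < s -> s < s0 -> exists Z : 'M[C]_(d, n),
     vec Z = vec Y + s%:C *: (M *m vec Z) /\ Q *m T *m Z = 0) ->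
  Q *m T *m Y = 0.
Proof.
move=> s00 h; have [mu hm] := opnorm_le_ex M; have [q hq] := opnorm_le_ex ((Q *m T) *t (1%:M : 'M_n)).
apply: (@vec_inj R); rewrite vec0; apply/eqP; rewrite -nrm_eq0 eq_le nrm_ge0 andbT.
have [mu0 q0] := (opnorm_le_ge0 hm, opnorm_le_ge0 hq).
pose s1 := Num.min s0 (2 * (mu + 1))^-1.
have s10 : 0 < s1 by rewrite lt_min s00 invr_gt0 mulr_gt0 // ltr_wpDl.
apply: (le0_small (a := q * (mu * (2 * nrm (vec Y)))) s10) => s sp.
rewrite lt_min => /andP[ss0 ss1]; have [Z [hZ QZ]] := h s sp ss0.
have nMZ : nrm (s%:C *: (M *m vec Z)) <= s * mu * nrm (vec Z).
  rewrite nrmZ -mulrA (_ : normc _ = s).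
    by rewrite ler_wpM2l ?(ltW sp) // hm.2.
  by rewrite /= expr0n addr0 sqrtr_sqr gtr0_norm.
have smu : s * mu <= 2^-1.
  have : s * (2 * (mu + 1)) < 1 by rewrite -ltr_pdivlMr ?div1r // mulr_gt0 // ltr_wpDl.
  by rewrite mulrCA mulrDr mulr1; lra.
have nZ : nrm (vec Z) <= 2 * nrm (vec Y).
  have : nrm (vec Z) <= nrm (vec Y) + s * mu * nrm (vec Z).
    by rewrite {1}hZ; apply: le_trans (nrmD _ _) _; rewrite lerD2l.
  have : s * mu * nrm (vec Z) <= 2^-1 * nrm (vec Z) by rewrite ler_wpM2r ?nrm_ge0.
  by lra.
have -> : vec (Q *m T *m Y) = - ((Q *m T) *t 1%:M *m (s%:C *: (M *m vec Z))).
  have -> : s%:C *: (M *m vec Z) = vec (Z - Y) by apply/eqP; rewrite vecB eq_sym subr_eq addrC; apply/eqP.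
  by rewrite tens_vec trmx1 mulmx1 mulmxBr QZ sub0r vecN opprK.
rewrite nrmN; apply: le_trans (hq.2 _) _; rewrite -mulrA ler_wpM2l //.
apply: le_trans nMZ _; rewrite [leRHS]mulrC [leRHS]mulrA; apply: ler_wpM2l nZ.
by rewrite mulr_ge0 // ltW.
Qed.

Lemma subr_eq_add (V : zmodType) (x y z : V) : x - y = z -> z + y = x.
Proof. by move=> <-; rewrite subrK. Qed.

Lemma normc_real (s : R) : 0 <= s -> normc s%:C = s.
Proof. by move=> s0; rewrite /= expr0n addr0 sqrtr_sqr ger0_norm. Qed.

Lemma opnorm_le_scalar n (s : R) : 0 <= s -> opnorm_le ((s%:C)%:M : 'M[C]_n) s.
Proof.
move=> s0; rewrite -scalemx1 -[s in opnorm_le _ s]mulr1 -[X in X * 1]normc_real //.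
by apply: opnorm_leZ; exact: opnorm_le1.
Qed.

Lemma lambda_mx_if g d n (B : 'I_g -> 'M[C]_d) (j0 : 'I_g) a (Y : 'M[C]_(d, n)) :
  lambda_mx B (fun j => if j == j0 then a%:M else 0) Y = a *: (B j0 *m Y).
Proof.
rewrite /lambda_mx (bigD1 j0) //= big1 => [|j /negPf ->]; last by rewrite trmx0 mulmx0.
by rewrite eqxx addr0 tr_scalar_mx mul_mx_scalar.
Qed.

Lemma adjt0 g m n : adjt (fun _ : 'I_g => 0 : 'M[C]_(m, n)) =1 fun=> 0.
Proof. by move=> j; rewrite /adjt adj0. Qed.

Lemma adjt_if g n j0 (s : R) :
  adjt (fun j : 'I_g => if j == j0 then (s%:C)%:M else 0 : 'M[C]_n) =1
  fun j => if j == j0 then (s%:C)%:M else 0.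
Proof.
move=> j; rewrite /adjt; case: ifP => _; last exact: adj0.
exact: adj_scalar.
Qed.

(** The last two clauses need all combinations [w] at one point [X] with one vector [v], which is
    why a solution of maximal rank is taken instead of a basis of words. *)
Lemma plush_reach g (r : sym_realization R g) : plush r ->
  exists n (Y : 'M[C]_(sym_size r, n)),
  [/\ exists b, sym_K r *m sym_c r = Y *m b,
      forall j, exists Z, sym_K r *m sym_B r j *m Y = Y *m Z,
      forall j, exists Z, sym_K r *m (sym_B r j)^h *m Y = Y *m Z,
      forall (eta : 'I_g -> 'cV_n) w, w = \sum_j sym_B r j *m Y *m eta j ->
        0 <= dotv w (sym_K r *m w)
    & forall (eta : 'I_g -> 'cV_n) w, w = \sum_j (sym_B r j)^h *m Y *m eta j ->
        0 <= dotv w (sym_K r *m w)].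
Proof.
case=> eps e0 hplush; set d := sym_size r.
have [t0 t00 hball] := @nc_ball_small R g eps e0.
(* The strict bound [t < t0] leaves room to perturb a point by a small block. *)
pose inside n (X : mxtuple R g n) := exists2 t, t < t0 & forall j, opnorm_le (X j) t.
have inB n (X : mxtuple R g n) : inside n X -> nc_ball eps X.
  by case=> t tt h; apply: hball => j; apply: opnorm_le_le (h j) (ltW tt).
have inD n (X : mxtuple R g n) : inside n X -> sym_dom r X.
  by move/inB/hplush => -[].
pose reached n (X : mxtuple R g n) v (Y : 'M[C]_(d, n)) :=
  inside n X /\ pencil_mx r X Y = sym_c r *m v^T.
have ex_reached n (X : mxtuple R g n) v : inside n X -> exists Y, reached n X v Y.
  move=> iX; exists (unvec (sym_Delta r X *m (ampl (sym_c r) n *m v))); split=> //.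
  apply: (@vec_inj R); rewrite -pencil_mxE unvecK -amplM.
  by rewrite /sym_Delta mulKVmx //; exact: inD.
have [n [X [v [Y [[iX eY] maxY]]]]] : exists n X v Y, reached n X v Y /\
    forall n' X' v' Y', reached n' X' v' Y' -> (\rank Y' <= \rank Y)%N.
  pose P k := `[< exists n X v Y, reached n X v Y /\ \rank Y = k >].
  have exP : exists k, P k.
    have in0 : inside 1%N (fun=> 0).
      by exists 0 => // j; exact: opnorm_le0.
    have [Y hY] := ex_reached _ _ 0 in0.
    by exists (\rank Y); apply/asboolP; exists 1%N, (fun=> 0), 0, Y.
  have leP k : P k -> (k <= d)%N.
    by move=> /asboolP[n [X [v [Y [_ <-]]]]]; exact: rank_leq_row.
  case: (ex_maxnP exP leP) => k /asboolP[n [X [v [Y [hY kY]]]]] hk.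
  exists n, X, v, Y; split=> // n' X' v' Y' h'; rewrite kY; apply: hk.
  by apply/asboolP; exists n', X', v', Y'.
(* The direct sum of both points has the solution [row_mx Y Y'], whose rank cannot exceed that of
   [Y]. *)
have sub n' (X' : mxtuple R g n') v' Y' : reached n' X' v' Y' -> exists Z, Y' = Y *m Z.
  move=> [[t' tt' hX'] eY']; case: iX => t tt hX.
  have /maxY : reached _ (blk X (fun=> 0) (fun=> 0) X') (col_mx v v') (row_mx Y Y').
    split.
      exists (Num.max t t'); first by rewrite gt_max tt tt'.
      move=> j; apply: opnorm_le_block_diag.
        by apply: opnorm_le_le (hX j) _; rewrite le_max lexx.
      by apply: opnorm_le_le (hX' j) _; rewrite le_max lexx orbT.
    rewrite pencil_mx_blk !lambda_mx0 !(eq_lamX (X' := fun=> 0) _ (fun=> erefl)) ?lambda_mx0 ?subr0;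
      do ?[by move=> j; rewrite /adjt adj0].
    by rewrite eY eY' tr_col_mx mul_mx_row.
  rewrite -mxrank_tr tr_row_mx -(mxrank_tr Y) => hr.
  have /submxP[Z hZ] : (Y'^T <= Y^T)%MS.
    apply: submx_trans (_ : (col_mx Y^T Y'^T <= Y^T)%MS).
      by rewrite -addsmxE addsmxSr.
    by rewrite -(geq_leqif (mxrank_leqif_sup _)) // -addsmxE addsmxSl.
  by exists Z^T; apply: trmx_inj; rewrite trmx_mul trmxK.
have KK : sym_K r *m sym_K r = 1%:M := (sym_K_signature r).2.
(* An off-diagonal block of size [s] added to [X] gives the solution a second block [s K D Z], which
   lies in the span of [Y]. The feedback on the first block [Z] is of order [s^2], so [Z] tends to
   [Y] as [s] tends to 0. *)
have inv (D : 'M[C]_d) (s0 : R) : 0 < s0 -> (forall s, 0 < s -> s < s0 ->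
    exists Z, pencil_mx r X Z = sym_c r *m v^T + (s ^+ 2)%:C *: (D^h *m sym_K r *m D *m Z)
      /\ exists Z', s%:C *: (sym_K r *m D *m Z) = Y *m Z') ->
    exists Z, sym_K r *m D *m Y = Y *m Z.
  move=> s00 h; suff : (cokermx Y^T)^T *m (sym_K r *m D) *m Y = 0.
    move=> h0; have /submxP[Z hZ] : ((sym_K r *m D *m Y)^T <= Y^T)%MS.
      by rewrite submxE; apply/eqP/trmx_inj; rewrite trmx_mul trmxK trmx0 mulmxA.
    by exists Z^T; apply: trmx_inj; rewrite hZ trmx_mul trmxK.
  have uX := inD _ _ iX.
  apply: (@kernel_limit _ _ _ _ _ (sym_Delta r X *m ((D^h *m sym_K r *m D) *t 1%:M))
     _ (s0 ^+ 2)); first by rewrite exprn_gt0.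
  (* The feedback is quadratic in [s], while [kernel_limit] expects a linear parameter. *)
  move=> s sp ss0; have qs : Num.sqrt s ^+ 2 = s by rewrite sqr_sqrtr // ltW.
  have [||Z [hZ [Z' hZ']]] := h (Num.sqrt s); first by rewrite sqrtr_gt0.
    by rewrite -ltr_sqr ?nnegrE ?sqrtr_ge0 ?ltW // qs.
  exists Z; split.
    apply: (can_inj (mulKmx uX)); rewrite mulmxDr !pencil_mxE eY hZ qs vecD; congr (_ + _).
    rewrite -scalemxAr -!mulmxA mulKVmx // [in RHS]mulmxA.
    by rewrite tens_vec trmx1 mulmx1 vecZ !mulmxA.
  have sn0 : (Num.sqrt s)%:C != 0 by rewrite fmorph_eq0 gt_eqF // sqrtr_gt0.
  apply: (scalerI sn0); rewrite scaler0 -mulmxA scalemxAr hZ' mulmxA.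
  by rewrite -[_ *m Y]trmxK trmx_mul trmxK mulmx_coker trmx0 mul0mx.
have [t tt hX] := iX.
have s00 : 0 < t0 - t by rewrite subr_gt0.
exists n, Y; split.
- have in0 : @inside 1%N (fun=> 0) by exists 0 => // j; exact: opnorm_le0.
  have [Y' hY'] := ex_reached _ _ 1%:M in0.
  have [b hb] := sub _ _ _ _ hY'; exists b; rewrite -hb.
  have := hY'.2; rewrite pencil_mx0 trmx1 mulmx1 => <-.
  by rewrite mulmxA KK mul1mx.
- move=> j0; apply: (inv _ _ s00) => s sp ss0.
  pose E := fun j : 'I_g => if j == j0 then (s%:C)%:M else 0 : 'M[C]_n.
  (* The lower left block couples through [B_j]; the upper right block in the next item couples
     through its adjoint. *)
  pose X' := blk X (fun=> 0 : 'M[C]_n) E (fun=> 0 : 'M_n).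
  have iX' : inside _ X'.
    exists (t + s); first by rewrite addrC -ltrBrDr.
    move=> j; rewrite /X' /blk (_ : block_mx _ _ _ _ =
      block_mx (X j) 0 0 0 + block_mx 0 0 (E j) 0); last first.
      by rewrite add_block_mx !(addr0, add0r).
    apply: opnorm_leD; first by apply: opnorm_le_block_diag (hX j) (opnorm_le_le (opnorm_le0 _ _ _) (opnorm_le_ge0 (hX j))).
    apply: opnorm_le_block_dl; rewrite /E; case: ifP => _; first exact/opnorm_le_scalar/ltW.
    by apply: opnorm_le_le (opnorm_le0 _ _ _) (ltW sp).
  have [Y' hY'] := ex_reached _ _ (col_mx v 0) iX'.
  have [Z hZ] := sub _ _ _ _ hY'; have := hY'.2.
  rewrite -[Y']hsubmxK /X' pencil_mx_blk pencil_mx0 !lambda_mx0 !(eq_lamX _ (fun=> erefl) (@adjt0 _ _ _)) !lambda_mx0 !subr0.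
  rewrite (eq_lamX _ (fun=> erefl) (@adjt_if _ _ _ _)) !lambda_mx_if tr_col_mx trmx0 mul_mx_row mulmx0.
  move/eq_row_mx => [h1 /eqP]; rewrite subr_eq0 => /eqP h2.
  have h3 : s%:C *: (sym_K r *m sym_B r j0 *m lsubmx Y') = rsubmx Y'.
    by rewrite -mulmxA scalemxAr -h2 mulmxA KK mul1mx.
  exists (lsubmx Y'); split; last by exists (rsubmx Z); rewrite h3 hZ -mulmx_rsub.
  rewrite -(subr_eq_add h1); congr (_ + _).
  by rewrite -h3 -scalemxAr scalerA -expr2 -rmorphXn !mulmxA.
- move=> j0; apply: (inv _ _ s00) => s sp ss0.
  pose E := fun j : 'I_g => if j == j0 then (s%:C)%:M else 0 : 'M[C]_n.
  pose X' := blk X E (fun=> 0 : 'M[C]_n) (fun=> 0 : 'M_n).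
  have iX' : inside _ X'.
    exists (t + s); first by rewrite addrC -ltrBrDr.
    move=> j; rewrite /X' /blk (_ : block_mx _ _ _ _ =
      block_mx (X j) 0 0 0 + block_mx 0 (E j) 0 0); last first.
      by rewrite add_block_mx !(addr0, add0r).
    apply: opnorm_leD; first by apply: opnorm_le_block_diag (hX j) (opnorm_le_le (opnorm_le0 _ _ _) (opnorm_le_ge0 (hX j))).
    apply: opnorm_le_block_ur; rewrite /E; case: ifP => _; first exact/opnorm_le_scalar/ltW.
    by apply: opnorm_le_le (opnorm_le0 _ _ _) (ltW sp).
  have [Y' hY'] := ex_reached _ _ (col_mx v 0) iX'.
  have [Z hZ] := sub _ _ _ _ hY'; have := hY'.2.
  rewrite -[Y']hsubmxK /X' pencil_mx_blk pencil_mx0 !lambda_mx0 !(eq_lamX _ (fun=> erefl) (@adjt0 _ _ _)) !lambda_mx0 !subr0.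
  rewrite (eq_lamX _ (fun=> erefl) (@adjt_if _ _ _ _)) !lambda_mx_if tr_col_mx trmx0 mul_mx_row mulmx0.
  move/eq_row_mx => [h1 /eqP]; rewrite subr_eq0 => /eqP h2.
  have h3 : s%:C *: (sym_K r *m (sym_B r j0)^h *m lsubmx Y') = rsubmx Y'.
    by rewrite -mulmxA scalemxAr -h2 mulmxA KK mul1mx.
  exists (lsubmx Y'); split; last by exists (rsubmx Z); rewrite h3 hZ -mulmx_rsub.
  rewrite -(subr_eq_add h1); congr (_ + _).
  by rewrite -h3 -scalemxAr scalerA -expr2 -rmorphXn !mulmxA adjK.
- move=> eta w w_def.
  (* On the border of size 1, where the point is 0, [Delta] acts as [K], which is its own inverse. A
     direction with rows [eta_j] in the lower left sends the solution to [(0, w)], and its adjoint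
     sends it to 0, so the Hessian reduces to [w' K w]. *)
  pose X' := blk X (fun=> 0 : 'M[C]_(n, 1)) (fun=> 0 : 'M[C]_(1, n)) (fun=> 0 : 'M_1).
  pose H := blk (fun=> 0 : 'M[C]_n) (fun=> 0 : 'M[C]_(n, 1)) (fun j : 'I_g => (eta j)^T) (fun=> 0 : 'M_1).
  have iX' : inside _ X'.
    exists t => // j; apply: opnorm_le_block_diag (hX j) _.
    by apply: opnorm_le_le (opnorm_le0 _ _ _) (opnorm_le_ge0 (hX j)).
  have penX' Y1 Y2 : pencil_mx r X' (row_mx Y1 Y2) = row_mx (pencil_mx r X Y1) (sym_K r *m Y2).
    rewrite /X' pencil_mx_blk pencil_mx0 !lambda_mx0 !(eq_lamX _ (fun=> erefl) (@adjt0 _ _ _)) !lambda_mx0.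
    by rewrite !subr0.
  have DX' Y1 Y2 : sym_Delta r X' *m vec (row_mx (pencil_mx r X Y1) (sym_K r *m Y2)) =
      vec (row_mx Y1 Y2).
    by rewrite -penX' -pencil_mxE /sym_Delta mulKmx //; exact: inD.
  have := (hplush _ X' (inB _ _ iX')).2 H (col_mx v 0).
  have wE : w = lambda_mx (sym_B r) (fun j => (eta j)^T) Y.
    by rewrite w_def; apply: eq_bigr => j _; rewrite trmxK.
  have aE : sym_Delta r X' *m ampl (sym_c r) (n + 1) *m col_mx v 0 = vec (row_mx Y 0).
    by rewrite -mulmxA amplM tr_col_mx trmx0 mul_mx_row mulmx0 -eY
      -[X in row_mx _ X](mulmx0 _ (sym_K r)) DX'.
  have LE : Lambda (sym_B r) H *m vec (row_mx Y 0) = vec (row_mx 0 w).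
    rewrite Lambda_vec -/(lambda_mx _ _ _) /H lambda_mx_blk !lambda_mx0r !lambda_mx0 !addr0 -wE //.
  have LaE : Lambda_adj (sym_B r) H *m vec (row_mx Y 0) = vec (row_mx 0 0).
    rewrite Lambda_adj_vec -/(lambda_mx (adjt (sym_B r)) (adjt H) _) (eq_lamX _ (fun=> erefl) (adjt_blk _ _ _ _)).
    by rewrite lambda_mx_blk !lambda_mx0r !(eq_lamX _ (fun=> erefl) (@adjt0 _ _ _)) !lambda_mx0 !addr0.
  rewrite complex_hessianE aE LE LaE row_mx0 vec0 dotv0l addr0.
  have := DX' 0 (sym_K r *m w).
  rewrite mulmxA KK mul1mx {1}/pencil_mx mulmx0 !lambda_mx0r !subr0 => ->.
  by rewrite dotv_vec_row_mx vec0 dotv0l add0r dotv_vec1.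
- move=> eta w w_def.
  pose X' := blk X (fun=> 0 : 'M[C]_(n, 1)) (fun=> 0 : 'M[C]_(1, n)) (fun=> 0 : 'M_1).
  (* In the upper right corner the roles of [Lambda] and of its adjoint are exchanged. *)
  pose H := blk (fun=> 0 : 'M[C]_n) (fun j : 'I_g => ((eta j)^T)^h) (fun=> 0 : 'M[C]_(1, n)) (fun=> 0 : 'M_1).
  have iX' : inside _ X'.
    exists t => // j; apply: opnorm_le_block_diag (hX j) _.
    by apply: opnorm_le_le (opnorm_le0 _ _ _) (opnorm_le_ge0 (hX j)).
  have penX' Y1 Y2 : pencil_mx r X' (row_mx Y1 Y2) = row_mx (pencil_mx r X Y1) (sym_K r *m Y2).
    rewrite /X' pencil_mx_blk pencil_mx0 !lambda_mx0 !(eq_lamX _ (fun=> erefl) (@adjt0 _ _ _)) !lambda_mx0.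
    by rewrite !subr0.
  have DX' Y1 Y2 : sym_Delta r X' *m vec (row_mx (pencil_mx r X Y1) (sym_K r *m Y2)) =
      vec (row_mx Y1 Y2).
    by rewrite -penX' -pencil_mxE /sym_Delta mulKmx //; exact: inD.
  have := (hplush _ X' (inB _ _ iX')).2 H (col_mx v 0).
  have wE : w = lambda_mx (adjt (sym_B r)) (adjt (fun j => ((eta j)^T)^h)) Y.
    by rewrite w_def; apply: eq_bigr => j _; rewrite /adjt adjK trmxK.
  have aE : sym_Delta r X' *m ampl (sym_c r) (n + 1) *m col_mx v 0 = vec (row_mx Y 0).
    by rewrite -mulmxA amplM tr_col_mx trmx0 mul_mx_row mulmx0 -eY
      -[X in row_mx _ X](mulmx0 _ (sym_K r)) DX'.
  have LE : Lambda (sym_B r) H *m vec (row_mx Y 0) = vec (row_mx 0 0).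
    by rewrite Lambda_vec -/(lambda_mx _ _ _) /H lambda_mx_blk !lambda_mx0r !lambda_mx0 !addr0.
  have LaE : Lambda_adj (sym_B r) H *m vec (row_mx Y 0) = vec (row_mx 0 w).
    rewrite Lambda_adj_vec -/(lambda_mx (adjt (sym_B r)) (adjt H) _) (eq_lamX _ (fun=> erefl) (adjt_blk _ _ _ _)).
    by rewrite lambda_mx_blk !lambda_mx0r !(eq_lamX _ (fun=> erefl) (@adjt0 _ _ _)) !lambda_mx0 !addr0 -wE.
  rewrite complex_hessianE aE LE LaE row_mx0 vec0 dotv0l add0r.
  have := DX' 0 (sym_K r *m w).
  rewrite mulmxA KK mul1mx {1}/pencil_mx mulmx0 !lambda_mx0r !subr0 => ->.
  by rewrite dotv_vec_row_mx vec0 dotv0l add0r dotv_vec1.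
Qed.

End Reach.

(** * Positive factorizations *)

Lemma herm_spectral (F : numClosedFieldType) n (A : 'M[F]_n) : A^t* = A ->
  exists (P : 'M[F]_n) (s : 'rV[F]_n), P *m P^t* = 1%:M /\ A = P^t* *m diag_mx s *m P.
Proof.
move=> hA; have nA : A \is normalmx by apply/normalmxP; rewrite hA.
exists (spectralmx A), (spectral_diag A); have uP := spectral_unitarymx A.
split; first exact/unitarymxP.
by rewrite -(invmx_unitary uP); exact: (orthomx_spectralP nA).
Qed.

Section LinAlg.
Variable R : realType.
Local Notation C := R[i].
Local Notation normc := (@ComplexField.Normc.normc R).

(** [A] preserves the rank of [Y], so [Y] and [Y W] have the same column span and
    [Y = Y W V = A Y V] for some [V]. *)
Lemma stable_invmx (F : fieldType) p q (A : 'M[F]_p) (Y : 'M[F]_(p, q)) W :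
  A \in unitmx -> A *m Y = Y *m W -> exists V, invmx A *m Y = Y *m V.
Proof.
move=> uA h; have /submxP[V hV] : (Y^T <= (Y *m W)^T)%MS.
  rewrite -(geq_leqif (mxrank_leqif_sup _)); last by rewrite trmx_mul submxMl.
  rewrite -h trmx_mul mxrankMfree //.
  by rewrite row_free_unit unitmx_tr.
exists V^T; have e : Y = Y *m W *m V^T by apply: trmx_inj; rewrite trmx_mul trmxK.
by rewrite [in LHS]e -h -mulmxA mulKmx.
Qed.

(** The adjoint of an inner inverse [A] of a Hermitian [G] is again one, and [A G A'] is then
    Hermitian and reflexive. *)
Lemma herm_ginv n (G : 'M[C]_n) : G^h = G ->
  exists H : 'M[C]_n, [/\ H^h = H, G *m H *m G = G & H *m G *m H = H].
Proof.
move=> hG; have [A GAG] : exists A : 'M[C]_n, G *m A *m G = G.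
  by exists (pinvmx G); exact: mulmxKpV.
have GAsG : G *m A^h *m G = G.
  have e : (G *m A *m G)^h = G^h by rewrite GAG.
  by move: e; rewrite !adjM hG mulmxA.
exists (A *m G *m A^h); split.
- by rewrite !adjM adjK hG mulmxA.
- by rewrite !mulmxA GAG GAsG.
- have e : A *m G *m A^h *m G *m (A *m G *m A^h) =
      A *m (G *m A^h *m G) *m A *m G *m A^h by rewrite !mulmxA.
  by rewrite e GAsG -(mulmxA A) -(mulmxA A) GAG.
Qed.

Lemma psd_factor n (A : 'M[C]_n) : A^h = A -> psdmx A -> exists F : 'M[C]_n, A = F^h *m F.
Proof.
move=> hA pA.
have [P [s [PP eA]]] : exists (P : 'M[C]_n) (s : 'rV[C]_n),
    P *m P^h = 1%:M /\ A = P^h *m diag_mx s *m P := herm_spectral hA.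
have PAP : P *m A *m P^h = diag_mx s.
  by rewrite eA !mulmxA PP mul1mx -mulmxA PP mulmx1.
have s0 i : 0 <= s 0 i.
  have := pA (P^h *m delta_mx i 0).
  rewrite -mulmxA -/(dotv _ _) dotv_adjl adjK 2!mulmxA PAP dotv_delta -colE.
  by rewrite !mxE eqxx.
exists (diag_mx (map_mx sqrtC s) *m P); rewrite adjM {1}eA -!mulmxA; congr (_ *m _).
rewrite !mulmxA; congr (_ *m _); rewrite /adj tr_diag_mx map_diag_mx mulmx_diag.
congr diag_mx; apply/rowP => i; rewrite !mxE.
rewrite [X in X * _](_ : _ = sqrtC (s 0 i)); first by rewrite -expr2 sqrtCK.
by apply: conj_Creal; rewrite ger0_real // sqrtC_ge0.
Qed.

Lemma psdmx_dotv n (A : 'M[C]_n) : (forall v, 0 <= dotv v (A *m v)) -> psdmx A.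
Proof. by move=> h v; rewrite -mulmxA; exact: h. Qed.

(* The tuple [S] is stacked into one matrix, so that positivity of [K] on the
   span of all the ranges is an ordinary quadratic form inequality. *)
Lemma range_factor (I : finType) n m (K : 'M[C]_n) (S : I -> 'M[C]_(n, m)) : K^h = K ->
  (forall eta w, w = \sum_i S i *m eta i -> 0 <= dotv w (K *m w)) ->
  exists F : 'M[C]_n, forall i j,
    (S i)^h *m K *m S j = (S i)^h *m F^h *m (F *m S j).
Proof.
move=> hK pK.
pose T : 'M[C]_(n, #|I| * m) :=
  \matrix_(a, k) S (enum_val (mxtens_unindex k).1) a (mxtens_unindex k).2.
have T_eta eta : T *m eta = \sum_i S i *m (row (enum_rank i) (unvec eta))^T.
  apply/colP => a; rewrite mxE big_mxtens summxE (reindex (@enum_rank I)) /=; last first.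
    by exists enum_val => i _; rewrite ?enum_rankK ?enum_valK.
  apply: eq_bigr => i _; rewrite mxE; apply: eq_bigr => b _.
  by rewrite !mxE mxtens_indexK enum_rankK.
have S_T i : exists J : 'M[C]_(#|I| * m, m), S i = T *m J.
  exists (\matrix_(k, b) (k == mxtens_index (enum_rank i, b))%:R).
  apply/matrixP => a b; rewrite mxE (bigD1 (mxtens_index (enum_rank i, b))) //= big1.
    by rewrite !mxE mxtens_indexK /= eqxx enum_rankK mulr1 addr0.
  by move=> k /negPf kn; rewrite !mxE kn mulr0.
have [J TJT] : exists J : 'M[C]_(#|I| * m, n), T *m J *m T = T by exists (pinvmx T); exact: mulmxKpV.
(* [T J] projects onto the range of [T], the only place where [K] is known to be positive. *)
have [||F eF] := @psd_factor n ((T *m J)^h *m K *m (T *m J)).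
- by move: (T *m J) => X; rewrite !adjM adjK hK mulmxA.
- apply: psdmx_dotv => v; rewrite -[_ *m K *m _ *m v]mulmxA -mulmxA dotv_adjr adjK -!(mulmxA T).
  by apply: pK; exact: T_eta.
exists F => i j; have [[Ji ->] [Jj ->]] := (S_T i, S_T j).
have e : T^h *m K *m T = T^h *m F^h *m (F *m T).
  have -> : T^h *m K *m T = T^h *m ((T *m J)^h *m K *m (T *m J)) *m T.
    by rewrite !mulmxA -adjM TJT -!mulmxA (mulmxA T J T) TJT.
  by rewrite eF !mulmxA.
rewrite adjM -!(mulmxA (Ji^h)); congr (_ *m _).
by move/(congr1 (fun M => M *m Jj)): e; rewrite !mulmxA.
Qed.

(** The range of [Y *t 1] is invariant under [K] times the pencil, hence under the inverse, and
    contains [K] times the right-hand side. This works on the whole domain, not only near 0. *)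
Lemma reach_invariant g (r : sym_realization R g) m (Y : 'M[C]_(sym_size r, m)) :
  (exists b, sym_K r *m sym_c r = Y *m b) ->
  (forall j, exists Z, sym_K r *m sym_B r j *m Y = Y *m Z) ->
  (forall j, exists Z, sym_K r *m (sym_B r j)^h *m Y = Y *m Z) ->
  forall n (X : mxtuple R g n) v, sym_dom r X ->
  exists Z : 'M[C]_(m, n), sym_Delta r X *m (ampl (sym_c r) n *m v) = vec (Y *m Z).
Proof.
move=> [b hb] /choice[A hA] /choice[A' hA'] n X v uX.
have KK : sym_K r *m sym_K r = 1%:M := (sym_K_signature r).2.
have uK1 := tens1_unit n (signature_unit (sym_K_signature r)).
pose W := (1%:M : 'M[C]_m) *t (1%:M : 'M[C]_n) - \sum_j (A j *t X j) - \sum_j (A' j *t (X j)^h).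
have hW : (sym_K r *t 1%:M *m sym_pencil r X) *m (Y *t 1%:M) = (Y *t 1%:M) *m W.
  rewrite /sym_pencil /W !mulmxBr !mulmxBl !tensmx_mul KK !mul1mx !mulmx1.
  rewrite /Lambda /Lambda_adj !mulmx_sumr !mulmx_suml; congr (_ - _ - _);
    apply: eq_bigr => j _; rewrite !tensmx_mul !mul1mx !mulmx1 ?hA //.
  by rewrite -hA'.
have uO : (sym_K r *t 1%:M *m sym_pencil r X) \in unitmx by rewrite unitmx_mul uK1.
have [V hV] := stable_invmx uO hW.
exists (unvec (V *m vec (b *m v^T))).
have <- : (Y *t 1%:M) *m (V *m vec (b *m v^T)) = vec (Y *m unvec (V *m vec (b *m v^T))).
  by rewrite -[V *m _ in LHS]unvecK tens_vec trmx1 mulmx1.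
rewrite [RHS]mulmxA -hV -[RHS]mulmxA tens_vec trmx1 mulmx1 (mulmxA Y) -hb -(mulmxA (sym_K r)) amplM.
apply: (can_inj (mulKmx uO)); rewrite mulKVmx // -mulmxA [sym_pencil r X *m _]mulKVmx //.
by rewrite tens_vec trmx1 mulmx1.
Qed.

(** [N K] is the [K]-selfadjoint projection onto a complement, in the span of [Y], of the vectors
    that are [K]-orthogonal to the whole span. The equations containing [N *m K *m Y] express that
    [c] and the [N B_j] do not see the vectors removed by it. *)
Lemma plush_data g (r : sym_realization R g) : plush r ->
  let K := sym_K r in let B := sym_B r in let c := sym_c r in
  exists (N F1 F2 : 'M[C]_(sym_size r)) m (Y : 'M[C]_(sym_size r, m)),
  [/\ N^h = N, N *m K *m N = N,
      forall j k, N *m (B j)^h *m N *m B k *m N =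
         N *m (B j)^h *m N *m F1^h *m (F1 *m N *m B k *m N),
      forall j k, N *m B j *m N *m (B k)^h *m N =
         N *m B j *m N *m F2^h *m (F2 *m N *m (B k)^h *m N) &
  [/\ c^h *m N *m K *m Y = c^h *m Y,
      forall j, N *m B j *m N *m K *m Y = N *m B j *m Y,
      forall j, N *m (B j)^h *m N *m K *m Y = N *m (B j)^h *m Y &
      forall n (X : mxtuple R g n) v, sym_dom r X ->
      exists Z : 'M[C]_(m, n), sym_Delta r X *m (ampl c n *m v) = vec (Y *m Z)]].
Proof.
move=> /plush_reach[m [Y [hb hB hBh p1 p2]]] K B c.
have hK : K^h = K := sym_K_herm r.
have KK : K *m K = 1%:M := (sym_K_signature r).2.
have inv := reach_invariant hb hB hBh.
pose G := Y^h *m K *m Y.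
have hG : G^h = G by rewrite !adjM adjK hK mulmxA.
have [H [hH GHG HGH]] := herm_ginv hG.
pose N := Y *m H *m Y^h.
have hN : N^h = N by rewrite !adjM adjK hH mulmxA.
have NKN : N *m K *m N = N.
  have -> : N *m K *m N = Y *m (H *m G *m H) *m Y^h by rewrite !mulmxA.
  by rewrite HGH.
have YKNKY : Y^h *m K *m N *m K *m Y = Y^h *m K *m Y.
  have -> : Y^h *m K *m N *m K *m Y = G *m H *m G by rewrite !mulmxA.
  by rewrite GHG.
have eN : N = Y *m H *m Y^h by [].
clearbody N; have factor (D : 'I_g -> 'M[C]_(sym_size r)) :
    (forall j, exists Z, K *m D j *m Y = Y *m Z) ->
    (forall (eta : 'I_g -> 'cV_m) w, w = \sum_j D j *m Y *m eta j -> 0 <= dotv w (K *m w)) ->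
    exists F : 'M[C]_(sym_size r), forall j k, N *m (D j)^h *m N *m D k *m N =
       N *m (D j)^h *m N *m F^h *m (F *m N *m D k *m N).
  move=> /choice[Z hZ] pD.
  have [|F hF] := @range_factor _ _ _ K (fun j => N *m D j *m N) hK.
    move=> eta w ->; pose zeta j := H *m (Y^h *m eta j).
    pose w' := \sum_j D j *m Y *m zeta j.
    have -> : \sum_j N *m D j *m N *m eta j = N *m w'.
      by rewrite mulmx_sumr; apply: eq_bigr => j _; rewrite {2}eN !mulmxA.
    have e : w' = K *m Y *m (\sum_j Z j *m zeta j).
      rewrite mulmx_sumr; apply: eq_bigr => j _.
      by rewrite !mulmxA -(mulmxA K Y) -hZ !mulmxA KK mul1mx.
    (* By [N K N = N] the left side is the form of [N] at [w']; the forms of [N] and [K] agree on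
       [K] times the span of [Y], which contains [w']. *)
    have -> : dotv (N *m w') (K *m (N *m w')) = dotv w' (K *m w'); last exact: pD.
    rewrite dotv_adjl hN !mulmxA NKN e.
    rewrite !(dotv_adjl (K *m Y)) adjM hK !mulmxA YKNKY.
    by rewrite -(mulmxA _ K K) KK mulmx1.
  exists F => j k; have := hF j k; rewrite !adjM hN.
  rewrite !mulmxA => <-; congr (_ *m _ *m _).
  by rewrite -(mulmxA _ N K) -(mulmxA _ (N *m K)) NKN.
have [F1 h1] := factor _ hB p1.
have [F2 h2] : exists F : 'M[C]_(sym_size r), forall j k,
    N *m B j *m N *m (B k)^h *m N = N *m B j *m N *m F^h *m (F *m N *m (B k)^h *m N).
  have [F hF] := factor (fun j => (B j)^h) hBh p2.
  by exists F => j k; have := hF j k; rewrite adjK.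
(* Invariance under [K D'] makes [Y' D] a multiple of [Y' K], and [Y' K N K Y = Y' K Y]. *)
have left_inv (D : 'M[C]_(sym_size r)) : (exists Z, K *m D^h *m Y = Y *m Z) ->
    Y^h *m D *m N *m K *m Y = Y^h *m D *m Y.
  case=> Z hZ; have -> : Y^h *m D = Z^h *m Y^h *m K.
    by rewrite -adjM -hZ !adjM adjK hK -!mulmxA KK mulmx1.
  by rewrite -!mulmxA; congr (_ *m _); rewrite !mulmxA.
exists N, F1, F2, m, Y; split=> //; split=> //.
- have [b eb] := hb; have -> : c^h = b^h *m Y^h *m K.
    by rewrite -adjM -eb adjM hK -mulmxA KK mulmx1.
  by rewrite -!mulmxA; congr (_ *m _); rewrite !mulmxA.
- move=> j; rewrite {1 3}eN -!mulmxA; do 2!congr (_ *m _); rewrite !mulmxA.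
  exact/left_inv/hBh.
- move=> j; rewrite {1 3}eN -!mulmxA; do 2!congr (_ *m _); rewrite !mulmxA.
  by apply: left_inv; rewrite adjK.
Qed.

End LinAlg.

(** * A convex model function *)

Section ConvexModel.
Variable R : realType.
Local Notation C := R[i].
Local Notation normc := (@ComplexField.Normc.normc R).
Local Notation cRe := (@complex.Re R).

Lemma half_complexE : (2^-1 : C) = (2^-1)%:C.
Proof. by rewrite fmorphV rmorph_nat. Qed.

Lemma conj_half : Num.conj (2^-1 : C) = 2^-1.
Proof. by rewrite half_complexE; exact: conjc_real. Qed.

Lemma ge0_herm n (A : 'M[C]_n) v : A^h = A -> 0 <= cRe (dotv v (A *m v)) ->
  0 <= dotv v (A *m v).
Proof.
move=> hA h; rewrite -[dotv _ _]RRe_real ?lecR //.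
by apply/CrealP; apply: etrans (dotv_conj _ _) _; rewrite dotv_adjl hA.
Qed.

Lemma herm_ge0_bound n (A E : 'M[C]_n) v : (A - E)^h = A - E ->
  (exists2 e, e <= 1 & opnorm_le E e) -> dotv v (A *m v) = dotv v v ->
  0 <= dotv v ((A - E) *m v).
Proof.
move=> hAE [e e1 [e0 hE]] hv; apply: ge0_herm => //.
rewrite mulmxBl dotvBr hv raddfB subr_ge0 /=.
apply: le_trans (Re_le_normc _) _; apply: le_trans (dotv_CauchySchwarz _ _) _.
rewrite -sqr_nrm /= expr2 ler_wpM2l ?nrm_ge0 //.
by apply: le_trans (hE v) _; rewrite ler_piMl ?nrm_ge0.
Qed.

Lemma midpoint_pencil m n (K a b a' b' : 'M[C]_(m, n)) :
  K - 2^-1 *: (a + b) - 2^-1 *: (a' + b') = 2^-1 *: (K - a - a' + (K - b - b')).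
Proof. by apply/matrixP => i j; rewrite !mxE; field. Qed.

Lemma quad_mid n (A B D : 'M[C]_n) v :
  dotv v ((2^-1 *: (A + B) - D) *m v) =
  2^-1 * (dotv v (A *m v) + dotv v (B *m v)) - dotv v (D *m v).
Proof. by rewrite mulmxBl dotvBr -scalemxAl dotvZr mulmxDl dotvDr. Qed.

(** The pencils [P] and [Q] at two points average to the pencil [M] at the midpoint, where [x] is
    the solution. The two lower bounds therefore average to [2 <x, M x> - <x, M x>], the value at
    the midpoint. *)
Lemma quad_mid_ge0 n p (A B D : 'M[C]_n) (P Q M : 'M[C]_p) v x c :
  dotv v (D *m v) = dotv x (M *m x) -> M = 2^-1 *: (P + Q) -> M^h = M -> c = M *m x ->
  dotv x c + dotv c x - dotv x (P *m x) <= dotv v (A *m v) ->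
  dotv x c + dotv c x - dotv x (Q *m x) <= dotv v (B *m v) ->
  0 <= dotv v ((2^-1 *: (A + B) - D) *m v).
Proof.
move=> hD hM hMh ->; rewrite (dotv_adjl M x x) hMh quad_mid hD => hA hB.
have e : dotv x (M *m x) = 2^-1 * (dotv x (P *m x) + dotv x (Q *m x)).
  by rewrite hM -scalemxAl dotvZr mulmxDl dotvDr.
rewrite subr_ge0; apply: le_trans (_ : 2^-1 * (dotv x (Q *m x) + dotv x (P *m x)) <= _).
  by rewrite e addrC.
rewrite ler_wpM2l ?invr_ge0 ?ler0n //; apply: lerD.
  by apply: le_trans hA; rewrite e le_eqVlt; apply/orP; left; apply/eqP; field.
by apply: le_trans hB; rewrite e le_eqVlt; apply/orP; left; apply/eqP; field.
Qed.

Section Def.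
Variables (kap : R) (d : nat).

(* In coordinates [(l, y, u, w)] the pencil of the model is
   [l' y + y' l + u' u + w' w] minus twice the real part of [(y, u)' x (y, w)],
   where [x = (a b; c s)]. Its first row fixes [y], and eliminating [l, u, w]
   gives [2 kap + a + a' + z' (1 - S)^-1 z] with [z = (c, b')], [S = (0 s; s' 0)]. *)
Definition model_R : 'M[C]_((1 + 1) + (d + d), 1 + d) :=
  col_mx (col_mx 0 (row_mx 1%:M 0)) (col_mx (row_mx 0 1%:M) 0).
Definition model_G : 'M[C]_((1 + 1) + (d + d), 1 + d) :=
  col_mx (col_mx 0 (row_mx 1%:M 0)) (col_mx 0 (row_mx 0 1%:M)).
Definition model_K : 'M[C]_((1 + 1) + (d + d)) :=
  block_mx (block_mx 0 1%:M 1%:M 0) 0 0 1%:M.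
Definition model_B : mxtuple R ((1 + d) * (1 + d)) ((1 + 1) + (d + d)) :=
  fun k => model_R *m delta_mx (mxtens_unindex k).1 (mxtens_unindex k).2 *m model_G^h.
Definition model_c : 'cV[C]_((1 + 1) + (d + d)) :=
  col_mx (col_mx 1%:M ((kap%:C)%:M)) 0.

Lemma model_K_signature : signature_mx model_K.
Proof.
split.
  rewrite -/(adj _) /model_K !adj_block_mx !adj0 !adj1 //.
rewrite /model_K !mulmx_block !(mulmx0, mul0mx, mulmx1, mul1mx, addr0, add0r).
by rewrite -!scalar_mx_block.
Qed.

Definition model : sym_realization R ((1 + d) * (1 + d)) :=
  @SymRealization R _ ((1 + 1) + (d + d)) isT model_K model_B model_c model_K_signature.

(** The tuple is read as a block operator [x] with [1 + d] block rows and columns, the index [k]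
    encoding a pair of block indices. [act] and [act_adj] are [x] and its adjoint under [vec]. *)
Definition act n (X : mxtuple R ((1 + d) * (1 + d)) n) (T : 'M[C]_(1 + d, n)) :=
  \sum_k delta_mx (mxtens_unindex k).1 (mxtens_unindex k).2 *m T *m (X k)^T.
Definition act_adj n (X : mxtuple R ((1 + d) * (1 + d)) n) (T : 'M[C]_(1 + d, n)) :=
  \sum_k delta_mx (mxtens_unindex k).2 (mxtens_unindex k).1 *m T *m ((X k)^h)^T.

Lemma pencil_mx_model n (X : mxtuple R ((1 + d) * (1 + d)) n) Y :
  pencil_mx model X Y = model_K *m Y - model_R *m act X (model_G^h *m Y)
                  - model_G *m act_adj X (model_R^h *m Y).
Proof.
rewrite /pencil_mx /lambda_mx; congr (_ - _ - _).
  by rewrite mulmx_sumr; apply: eq_bigr => k _; rewrite /= /model_B !mulmxA.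
rewrite mulmx_sumr; apply: eq_bigr => k _; rewrite /adjt /= /model_B !adjM adj_delta adjK.
by rewrite !mulmxA.
Qed.

Lemma model_adjR n (l y : 'M[C]_(1, n)) (u w : 'M[C]_(d, n)) :
  model_R^h *m col_mx (col_mx l y) (col_mx u w) = col_mx y u.
Proof.
rewrite /model_R !adj_col_mx !adj_row_mx !adj0 !adj1 !mul_row_col.
by rewrite !(mul_col_mx, mul0mx, mul1mx, add0r, addr0) add_col_mx !(add0r, addr0).
Qed.

Lemma model_adjG n (l y : 'M[C]_(1, n)) (u w : 'M[C]_(d, n)) :
  model_G^h *m col_mx (col_mx l y) (col_mx u w) = col_mx y w.
Proof.
rewrite /model_G !adj_col_mx !adj_row_mx !adj0 !adj1 !mul_row_col.
by rewrite !(mul_col_mx, mul0mx, mul1mx, add0r, addr0) add_col_mx !(add0r, addr0).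
Qed.

Lemma model_RM n (y : 'M[C]_(1, n)) (u : 'M[C]_(d, n)) :
  model_R *m col_mx y u = col_mx (col_mx 0 y) (col_mx u 0).
Proof.
by rewrite /model_R !mul_col_mx !mul_row_col !(mul0mx, mul1mx, add0r, addr0).
Qed.

Lemma model_GM n (y : 'M[C]_(1, n)) (u : 'M[C]_(d, n)) :
  model_G *m col_mx y u = col_mx (col_mx 0 y) (col_mx 0 u).
Proof.
by rewrite /model_G !mul_col_mx !mul_row_col !(mul0mx, mul1mx, add0r, addr0).
Qed.

Lemma model_KM n (l y : 'M[C]_(1, n)) (w : 'M[C]_(d + d, n)) :
  model_K *m col_mx (col_mx l y) w = col_mx (col_mx y l) w.
Proof.
by rewrite /model_K !mul_block_col !(mul0mx, mul1mx, add0r, addr0).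
Qed.

Lemma pencil_mx_modelE n (X : mxtuple R ((1 + d) * (1 + d)) n) l y (u w : 'M[C]_(d, n)) :
  let P := act X (col_mx y w) in let Q := act_adj X (col_mx y u) in
  pencil_mx model X (col_mx (col_mx l y) (col_mx u w)) =
  col_mx (col_mx y (l - usubmx P - usubmx Q)) (col_mx (u - dsubmx P) (w - dsubmx Q)).
Proof.
move=> P Q; rewrite pencil_mx_model model_adjG model_adjR model_KM -/P -/Q.
rewrite -[P]vsubmxK -[Q]vsubmxK model_RM model_GM !opp_col_mx !add_col_mx !oppr0 !addr0.
by rewrite !col_mxKu !col_mxKd.
Qed.

Lemma model_c_mul n (v : 'cV[C]_n) :
  model_c *m v^T = col_mx (col_mx v^T (kap%:C *: v^T)) (col_mx 0 0).
Proof. by rewrite /model_c !mul_col_mx mul1mx mul0mx mul_scalar_mx col_mx0. Qed.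

Lemma dotv_vec_col_mx m p n (A A' : 'M[C]_(m, n)) (D D' : 'M[C]_(p, n)) :
  dotv (vec (col_mx A D)) (vec (col_mx A' D')) = dotv (vec A) (vec A') + dotv (vec D) (vec D').
Proof. by rewrite !dotv_vec adj_col_mx mul_row_col linearD. Qed.

(** On vectors with [y = 0] the indefinite part [l' y + y' l] vanishes and [l] decouples. What
    remains is the identity on [z], perturbed by an operator of norm at most 1. *)
Lemma model_psd : exists2 t : R, 0 < t &
  forall n (X : mxtuple R ((1 + d) * (1 + d)) n), (forall k, opnorm_le (X k) t) ->
  sym_dom model X /\ forall (l : 'M[C]_(1, n)) (z : 'M[C]_(d + d, n)) y,
    y = vec (col_mx (col_mx l 0) z) -> 0 <= dotv y (sym_pencil model X *m y).
Proof.
have [t1 [b [t10 _ h1]]] := sym_near0 model.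
have [l l0 hl] := opnorm_le_Lambda model_B.
pose t := Num.min t1 (2 * l)^-1.
have t0 : 0 < t by rewrite lt_min t10 invr_gt0 mulr_gt0.
exists t => // n X hX; split.
  by apply: (h1 _ _ _).1 => k; apply: opnorm_le_le (hX k) _; rewrite ge_min lexx.
move=> m z y ->; have hL := hl n X t (ltW t0) hX.
rewrite [X in 0 <= X](_ : _ =
    dotv (vec (col_mx (col_mx 0 0) z)) (sym_pencil model X *m vec (col_mx (col_mx 0 0) z))); last first.
  rewrite !pencil_mxE -[z]vsubmxK !pencil_mx_modelE !dotv_vec_col_mx !vec0 !dotv0l !dotv0r.
  by rewrite !addr0.
have pE : sym_pencil model X =
    model_K *t 1%:M - (Lambda model_B X + (Lambda model_B X)^h).
  by rewrite /sym_pencil Lambda_adjE opprD addrA.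
have hP := sym_pencil_herm model X.
rewrite pE; apply: herm_ge0_bound; first by rewrite -pE.
  exists (l * t + l * t); last by apply: opnorm_leD => //; exact: opnorm_le_adj.
  have : l * t <= l * (2 * l)^-1 by rewrite ler_wpM2l ?(ltW l0) // ge_min lexx orbT.
  have -> : l * (2 * l)^-1 = 2^-1 by rewrite invfM mulrCA mulfV ?mulr1 // gt_eqF.
  by lra.
by rewrite tens_vec trmx1 mulmx1 model_KM.
Qed.

Lemma model_convex : exists2 eps : R, 0 < eps & convex_on eps model.
Proof.
have [t t0 ht] := model_psd; exists t => //.
have hB n (X : mxtuple R ((1 + d) * (1 + d)) n) : nc_ball t X -> forall k, opnorm_le (X k) t.
  by move=> hX k; apply: nc_ball_opnorm_le hX; exact: ltW.
split=> [n X /hB/ht[] //|n X Y /hB hX /hB hY].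
have hM k : opnorm_le (midpoint X Y k) t.
  apply: opnorm_le_le (opnorm_leZ _ (opnorm_leD (hX k) (hY k))) _.
  rewrite half_complexE normc_real ?invr_ge0 //.
  by lra.
have [[[uX pX] [uY pY]] [uM _]] := (ht _ _ hX, ht _ _ hY, ht _ _ hM).
apply: psdmx_dotv => v; pose c := ampl model_c n *m v.
pose xi Z := sym_Delta model Z *m c.
have val Z : sym_dom model Z ->
   dotv v (sym_eval model Z *m v) = dotv (xi Z) (sym_pencil model Z *m xi Z).
  move=> uZ; rewrite /sym_eval -/(adj _) -!mulmxA dotv_adjr adjK -/c -/(xi Z).
  by rewrite /xi /sym_Delta mulKVmx // dotv_adjl -/(sym_Delta model Z) sym_Delta_herm.
(* The first row of the pencil equation reads [y = v^T] at every point. Differences of solutions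
   thus have [y = 0], which is where the pencil is positive. *)
have comp Z : sym_dom model Z -> exists l z, xi Z = vec (col_mx (col_mx l v^T) z).
  move=> uZ; pose W := unvec (xi Z).
  exists (usubmx (usubmx W)), (dsubmx W); rewrite -[LHS]unvecK -/W.
  have : sym_pencil model Z *m vec W = c by rewrite unvecK /xi /sym_Delta mulKVmx.
  have eW : W = col_mx (col_mx (usubmx (usubmx W)) (dsubmx (usubmx W)))
    (col_mx (usubmx (dsubmx W)) (dsubmx (dsubmx W))) by rewrite !vsubmxK.
  rewrite {1}eW pencil_mxE pencil_mx_modelE /c amplM model_c_mul.
  by move=> /(@vec_inj R) /eq_col_mx[] /eq_col_mx[<- _] _; rewrite !vsubmxK.
(* [f Z] dominates a function that is affine in [Z], with equality at the
   point where [x] is the solution for [Z]. *)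
have gap Z : sym_dom model Z -> (forall (l : 'M[C]_(1, n)) (z : 'M[C]_(d + d, n)) y,
    y = vec (col_mx (col_mx l 0) z) -> 0 <= dotv y (sym_pencil model Z *m y)) ->
    forall x, (exists l z, x = vec (col_mx (col_mx l v^T) z)) ->
    dotv x c + dotv c x - dotv x (sym_pencil model Z *m x)
      <= dotv v (sym_eval model Z *m v).
  move=> uZ pZ x [l [z ->]]; rewrite val // -subr_ge0.
  set x' := vec _; have [l' [z' e]] := comp Z uZ.
  rewrite [X in 0 <= X](_ : _ = dotv (x' - xi Z) (sym_pencil model Z *m (x' - xi Z))).
    apply: (pZ (l - l') (z - z')); rewrite /x' e -vecB.
    by rewrite !opp_col_mx !add_col_mx subrr.
  have -> : c = sym_pencil model Z *m xi Z by rewrite /xi /sym_Delta mulKVmx.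
  have hP := sym_pencil_herm model Z.
  move: (sym_pencil model Z) (xi Z) x' hP => P w x' hP.
  by rewrite mulmxBr !dotvBr !dotvBl (dotv_adjl P x' w) hP; ring.
have hx := comp _ uM; have gX := gap _ uX pX _ hx; have gY := gap _ uY pY _ hx.
have pM : sym_pencil model (midpoint X Y) = 2^-1 *: (sym_pencil model X + sym_pencil model Y).
  rewrite /sym_pencil.
  have -> : Lambda (sym_B model) (midpoint X Y) =
      2^-1 *: (Lambda (sym_B model) X + Lambda (sym_B model) Y).
    rewrite /Lambda -big_split scaler_sumr; apply: eq_bigr => j _ /=.
    by apply/matrixP => a b; rewrite !mxE; ring.
  have -> : Lambda_adj (sym_B model) (midpoint X Y) =
      2^-1 *: (Lambda_adj (sym_B model) X + Lambda_adj (sym_B model) Y).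
    rewrite !Lambda_adjE.
    have -> : Lambda (sym_B model) (midpoint X Y) =
      2^-1 *: (Lambda (sym_B model) X + Lambda (sym_B model) Y).
      rewrite /Lambda -big_split scaler_sumr; apply: eq_bigr => j _ /=.
      by apply/matrixP => a b'; rewrite !mxE; ring.
    rewrite adjZ adjD; congr (_ *: _); exact: conj_half.
  exact: midpoint_pencil.
have eM : c = sym_pencil model (midpoint X Y) *m xi (midpoint X Y).
  by rewrite /xi /sym_Delta mulKVmx.
exact: (quad_mid_ge0 (val _ uM) pM (sym_pencil_herm _ _) eM gX gY).
Qed.

End Def.
End ConvexModel.

(** * The analytic mapping *)

Section Analytic.
Variable R : realType.
Local Notation C := R[i].

Lemma mulmx_ext m n (A B : 'M[C]_(m, n)) : (forall v : 'cV_n, A *m v = B *m v) -> A = B.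
Proof.
move=> h; apply/trmx_inj/row_matrixP => i; rewrite -!tr_col; congr (_^T).
by rewrite !colE h.
Qed.

Section Component.
Variables (g d : nat) (d_gt0 : (0 < d)%N) (N : 'M[C]_d) (B : mxtuple R g d).

(** The second block carries no variable: it supplies the constant that is to be subtracted. *)
Definition comp_A : mxtuple R g (d + d) := fun j => block_mx (N *m B j) 0 0 0.

Lemma comp_size : (0 < d + d)%N. Proof. by rewrite addn_gt0 d_gt0. Qed.

(* The realization of [al^* (1 - N L)^-1 N be - al^* N be], with [L = Lambda_B(x)]. *)
Definition an_comp (al be : 'cV[C]_d) : an_realization R g :=
  @AnRealization R g (d + d) comp_size 1%:M comp_A
    (col_mx (N *m be) (N *m be)) (col_mx al (- al)) (unitmx1 _ _).

Definition res_op n (X : mxtuple R g n) : 'M[C]_(d * n) :=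
  1%:M - (N *t 1%:M) *m Lambda B X.

(** The operator [Q] of the overview. Subtracting [N] makes it vanish at [X = 0], so that
    [q(0) = 0]. *)
Definition hat_op n (X : mxtuple R g n) : 'M[C]_(d * n) :=
  invmx (res_op X) *m (N *t 1%:M) - N *t 1%:M.

Lemma an_pencil_comp al be n (X : mxtuple R g n) Y Z :
  an_pencil (an_comp al be) X *m vec (col_mx Y Z) =
  vec (col_mx (unvec (res_op X *m vec Y)) Z).
Proof.
rewrite /an_pencil /res_op !mulmxBl mul1mx Lambda_vec -[(N *t _) *m _ *m _]mulmxA Lambda_vec !tens_vec.
rewrite !trmx1 !mulmx1 mul1mx -!vecB vecK; congr vec.
have -> : \sum_j comp_A j *m col_mx Y Z *m (X j)^T =
    col_mx (N *m (\sum_j B j *m Y *m (X j)^T)) 0.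
  rewrite mulmx_sumr -[RHS]add0r; elim/big_rec2: _ => [|j y x _]; first by rewrite col_mx0 addr0.
  rewrite !add0r => ->; rewrite /comp_A mul_block_col !mul0mx !addr0 mul_col_mx mul0mx.
  by rewrite add_col_mx addr0 !mulmxA.
by rewrite opp_col_mx add_col_mx oppr0 addr0.
Qed.

Lemma an_dom_comp al be n (X : mxtuple R g n) :
  an_dom (an_comp al be) X -> res_op X \in unitmx.
Proof.
move=> u; apply: unitmx_inj => v hv.
have : an_pencil (an_comp al be) X *m vec (col_mx (unvec v) 0) = 0.
  by rewrite an_pencil_comp unvecK hv -(vec0 _ d n) vecK col_mx0 vec0.
move/(congr1 (mulmx (invmx (an_pencil (an_comp al be) X)))); rewrite mulKmx // mulmx0.
rewrite -(vec0 _ (d + d) n) => /(@vec_inj R); rewrite -[X in _ = X]col_mx0 => /eq_col_mx[h _].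
by rewrite -[v]unvecK h vec0.
Qed.

Lemma an_eval_comp al be n (X : mxtuple R g n) : an_dom (an_comp al be) X ->
  an_eval (an_comp al be) X = (ampl al n)^h *m hat_op X *m ampl be n.
Proof.
move=> u; have uM := an_dom_comp u; apply: mulmx_ext => v.
pose W := invmx (res_op X) *m (vec (N *m be *m v^T)).
rewrite (@an_evalE R g (an_comp al be) n X (col_mx (unvec W) (N *m be *m v^T)) v) //.
  rewrite -[RHS]mulmxA amplM -[RHS]mulmxA /hat_op mulmxBl -[_ *m _ *m vec _]mulmxA tens_vec trmx1 mulmx1.
  rewrite (mulmxA N) -/W.
  rewrite -[W]unvecK -vecB ampl_adj vecK; congr (_^T).
  by rewrite adj_col_mx mul_row_col adjN mulNmx mulmxBr.
by rewrite an_pencil_comp unvecK mulKVmx // vecK amplM mul_col_mx.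
Qed.

End Component.

Lemma sum_col_row m n p (A : 'M[C]_(m, n)) (T : 'M[C]_(n, p)) :
  \sum_b col b A *m row b T = A *m T.
Proof.
apply/matrixP => i j; rewrite summxE mxE; apply: eq_bigr => b _.
by rewrite mxE big_ord1 !mxE.
Qed.

Lemma sum_delta_row m n (A : 'M[C]_(m, n)) :
  \sum_a delta_mx a 0 *m row a A = A.
Proof.
rewrite -[RHS]mul1mx -sum_col_row; apply: eq_bigr => a _; congr (_ *m _).
by apply/matrixP => i j; rewrite !mxE [j]ord1 eqxx andbT eq_sym.
Qed.

(* The block operator with blocks [(col a al (x) 1)^* Q (col b be (x) 1)] is
   [(al (x) 1)^* Q (be (x) 1)]. *)
Lemma act_sandwich d e n (al be : 'M[C]_(d, e)) (Q : 'M[C]_(d * n)) (T : 'M[C]_(e, n)) :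
  \sum_a \sum_b delta_mx a b *m T *m
     ((ampl (col a al) n)^h *m Q *m ampl (col b be) n)^T =
  al^h *m unvec (Q *m vec (be *m T)).
Proof.
rewrite -[RHS]sum_delta_row; apply: eq_bigr => a _.
have term b : delta_mx a b *m T *m ((ampl (col a al) n)^h *m Q *m ampl (col b be) n)^T =
    delta_mx a 0 *m ((col a al)^h *m unvec (Q *m vec (col b be *m row b T))).
  rewrite -(mul_delta_mx (0 : 'I_1)) -!mulmxA; congr (_ *m _).
  rewrite mulmxA -rowE -[row b T]trmxK -trmx_mul -!mulmxA amplM trmxK.
  by rewrite -[Q *m _ in LHS]unvecK ampl_adj trmxK.
under eq_bigr => b _ do rewrite term.
rewrite -mulmx_sumr -mulmx_sumr; congr (_ *m _).
have -> : (col a al)^h = row a al^h by apply/matrixP => i j; rewrite !mxE.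
rewrite row_mul; congr (_ *m _); apply: (@vec_inj R); rewrite vec_sum unvecK.
by under eq_bigr => b _ do rewrite unvecK; rewrite -mulmx_sumr -vec_sum sum_col_row.
Qed.


(** [Q = (1 - N L)^-1 N - N] equals [(1 - N L)^-1 N L N], so [s'] may be replaced by [s], for which
    [(1 - N L) y = N s] gives [Q s = y - N s]. The freedom in [s'] is what lets [F' F] take the
    place of [N]. *)
Lemma hat_solve p (N L : 'M[C]_p) (s s' y : 'cV[C]_p) : (1%:M - N *m L) \in unitmx ->
  y = N *m s + N *m (L *m y) -> N *m (L *m (N *m s')) = N *m (L *m (N *m s)) ->
  (invmx (1%:M - N *m L) *m N - N) *m s' = N *m (L *m y).
Proof.
move=> u ey es; set w := N *m (L *m y).
have e : (1%:M - N *m L) *m (w + N *m s') = N *m s'.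
  have h : N *m (L *m (N *m s')) + N *m (L *m w) = w.
    by rewrite es /w -2!mulmxDr -ey.
  by rewrite mulmxBl mul1mx -mulmxA !mulmxDr [X in _ - X]addrC h addrAC subrr add0r.
by rewrite mulmxBl -mulmxA -[X in invmx _ *m X]e mulKmx // addrK.
Qed.

(** Here the inverse stands on the right, as in the adjoint of [Q]. [L N s'] and [L N s] may differ,
    so their difference [t] is carried along until [N] kills it. *)
Lemma hat_adj_solve p (N L : 'M[C]_p) (s s' y : 'cV[C]_p) : (1%:M - L *m N) \in unitmx ->
  y = N *m s + N *m (L *m y) -> N *m (L *m (N *m s')) = N *m (L *m (N *m s)) ->
  (N *m invmx (1%:M - L *m N) - N) *m s' = N *m (L *m y).
Proof.
move=> u ey es; have [t et] : exists t, t = L *m (N *m s') - L *m (N *m s) by eexists.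
have Nt : N *m t = 0 by rewrite et mulmxBr es subrr.
have e : (1%:M - L *m N) *m (s' + (L *m y + t)) = s'.
  have h : L *m (N *m s) + L *m (N *m (L *m y)) = L *m y by rewrite -mulmxDr -ey.
  rewrite mulmxBl mul1mx -mulmxA !mulmxDr Nt mulmx0 addr0 -addrA -[RHS]addr0; congr (_ + _).
  rewrite -{1}h et; move: (L *m _) (L *m _) (L *m _) => a b e.
  by apply/colP => i; rewrite !mxE; ring.
rewrite mulmxBl -mulmxA -{1}e mulKmx // !mulmxDr Nt addr0.
by rewrite addrAC subrr add0r.
Qed.

Lemma tens_sum_mul g a b d m n p (U : 'I_g -> 'M[C]_(a, b)) (V : 'I_g -> 'M[C]_(b, d))
    (X : 'I_g -> 'M[C]_(m, n)) (Z : 'I_g -> 'M[C]_(n, p)) :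
  (\sum_j U j *t X j) *m (\sum_k V k *t Z k) =
  \sum_j \sum_k (U j *m V k) *t (X j *m Z k).
Proof.
rewrite mulmx_suml; apply: eq_bigr => j _; rewrite mulmx_sumr.
by apply: eq_bigr => k _; rewrite tensmx_mul.
Qed.

Lemma tens_mul_sum g a b d m n (A : 'M[C]_(a, b)) (U : 'I_g -> 'M[C]_(b, d))
    (X : 'I_g -> 'M[C]_(m, n)) :
  (A *t 1%:M) *m (\sum_j U j *t X j) = \sum_j (A *m U j) *t X j.
Proof. by rewrite mulmx_sumr; apply: eq_bigr => j _; rewrite tensmx_mul mul1mx. Qed.

Lemma sum_tens_mul g a b d m n (A : 'M[C]_(b, d)) (U : 'I_g -> 'M[C]_(a, b))
    (X : 'I_g -> 'M[C]_(m, n)) :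
  (\sum_j U j *t X j) *m (A *t 1%:M) = \sum_j (U j *m A) *t X j.
Proof. by rewrite mulmx_suml; apply: eq_bigr => j _; rewrite tensmx_mul mulmx1. Qed.

Lemma sum_tens_vec g a b m n (U : 'I_g -> 'M[C]_(a, b)) (X : 'I_g -> 'M[C]_(m, n)) W :
  (\sum_j U j *t X j) *m vec W = vec (\sum_j U j *m W *m (X j)^T).
Proof. by rewrite mulmx_suml vec_sum; apply: eq_bigr => j _; rewrite tens_vec. Qed.

End Analytic.

(** * From plush to convex composition *)

Section Forward.
Variable R : realType.
Local Notation C := R[i].

(** The product of the two sums runs over all pairs of indices, so one [F] has to serve all pairs
    [j], [k]. *)
Lemma tens_quad g d n (N F : 'M[C]_d) (T V : 'I_g -> 'M[C]_d) (XT XV : mxtuple R g n)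
    (w : 'cV[C]_(d * n)) :
  (forall j k, N *m T j *m N *m V k *m N = N *m T j *m N *m F^h *m (F *m N *m V k *m N)) ->
  (N *t 1%:M) *m ((\sum_j T j *t XT j) *m ((N *t 1%:M) *m (((F^h *m F *m N) *t 1%:M) *m
     ((\sum_k V k *t XV k) *m ((N *t 1%:M) *m w))))) =
  (N *t 1%:M) *m ((\sum_j T j *t XT j) *m ((N *t 1%:M) *m
     ((\sum_k V k *t XV k) *m ((N *t 1%:M) *m w)))).
Proof.
move=> hF.
have eV := sum_tens_mul N V XV; have eT := tens_mul_sum N T XT.
have eTN := sum_tens_mul N (fun j => N *m T j) XT.
have eTF := sum_tens_mul (F^h *m F *m N) (fun j => N *m T j *m N) XT.
have e1 := tens_sum_mul (fun j => N *m T j *m N) (fun k => V k *m N) XT XV.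
have e2 := tens_sum_mul (fun j => N *m T j *m N *m (F^h *m F *m N)) (fun k => V k *m N) XT XV.
have e12 : \sum_j \sum_k (N *m T j *m N *m (F^h *m F *m N) *m (V k *m N)) *t (XT j *m XV k) =
           \sum_j \sum_k (N *m T j *m N *m (V k *m N)) *t (XT j *m XV k).
  apply: eq_bigr => j _; apply: eq_bigr => k _; congr (_ *t _).
  by have := hF j k; rewrite !mulmxA => ->.
rewrite -e1 -e2 -eTF -eTN -eT -eV in e12.
have assoc p (N1 ST E SV : 'M[C]_p) (u : 'cV_p) :
    N1 *m ST *m N1 *m E *m (SV *m N1) = N1 *m ST *m N1 *m (SV *m N1) ->
    N1 *m (ST *m (N1 *m (E *m (SV *m (N1 *m u))))) = N1 *m (ST *m (N1 *m (SV *m (N1 *m u)))).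
  by rewrite !mulmxA => ->.
exact: assoc e12.
Qed.

Lemma mulmx_add3 p (N L : 'M[C]_p) (a w1 w2 : 'cV[C]_p) :
  N *m (L *m (N *m w1)) = N *m (L *m (N *m w2)) ->
  N *m (L *m (N *m (a + w1))) = N *m (L *m (N *m (a + w2))).
Proof. by move=> h; rewrite !mulmxDr h. Qed.

Theorem plush_decomposition g (r : sym_realization R g) : plush r ->
  exists (h : nat) (f : sym_realization R h) (q : an_mapping R g h),
    [/\ (0 < h)%N,
        exists eps : R, [/\ 0 < eps, convex_on eps f & nc_ball eps (map_at0 q)]
      & nc_comp_eq r f q].
Proof.
move=> /plush_data[N [F1 [F2 [m [Y]]]]].
set d := sym_size r; set K := sym_K r; set B := sym_B r; set c := sym_c r.
move=> [hN NKN h1 h2 [cY NBY NBhY inv]].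
have d0 : (0 < d)%N := sym_size_gt0 r.
pose al := row_mx c F1^h : 'M[C]_(d, 1 + d).
pose be := row_mx c F2^h : 'M[C]_(d, 1 + d).
pose z := (c^h *m N *m c) 0 0.
(* The model contributes [2 kap], which must be the constant term [c' N c] of [r]; this is real
   since [N] is Hermitian. *)
pose kap := 2^-1 * complex.Re z.
have zE : z = (kap + kap)%:C.
  have -> : kap + kap = complex.Re z by rewrite /kap; field.
  rewrite RRe_real //; apply/CrealP.
  have -> : z = dotv c (N *m c) by rewrite /z /dotv mulmxA.
  by apply: etrans (dotv_conj _ _) _; rewrite dotv_adjl hN.
pose f := model kap d.
pose q : an_mapping R g ((1 + d) * (1 + d)) := fun k =>
  an_comp d0 N B (col (mxtens_unindex k).1 al) (col (mxtens_unindex k).2 be).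
exists ((1 + d) * (1 + d))%N, f, q; split=> //.
  have [eps e0 cf] := @model_convex R kap d; exists eps; split=> //.
  apply: (@opnorm_le_nc_ball _ _ _ _ _ (fun=> 0)) => [k|]; last first.
    by rewrite big1 ?exprn_gt0 // => k _; rewrite expr0n.
  rewrite /map_at0 /map_eval.
  have L0 : Lambda B (fun _ : 'I_g => 0 : 'M[C]_1) = 0.
    by apply: big1 => j _; rewrite tensmx0.
  have u : an_dom (q k) (fun _ : 'I_g => 0 : 'M[C]_1).
    rewrite /an_dom /an_pencil /Lambda big1 ?subr0 => [|j _]; last by rewrite tensmx0.
    exact/tens1_unit/unitmx1.
  rewrite an_eval_comp // /hat_op /res_op L0 mulmx0 subr0 invmx1 mul1mx subrr.
  by rewrite mulmx0 mul0mx; exact: opnorm_le0.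
move=> n X uX uq uf; apply: mulmx_ext => v.
have uM : res_op N B X \in unitmx.
  by apply: (@an_dom_comp _ _ _ d0 _ _ (col 0 al) (col 0 be)); have := uq (mxtens_index (0, 0));
     rewrite /q mxtens_indexK.
pose y := sym_Delta r X *m (ampl c n *m v).
have e : sym_pencil r X *m y = ampl c n *m v by rewrite /y /sym_Delta mulKVmx.
have [Z yE] : exists Z, y = vec (Y *m Z) := inv n X v uX.
clearbody y.
pose N1 := N *t (1%:M : 'M[C]_n); pose K1 := K *t (1%:M : 'M[C]_n).
pose L := Lambda B X.
(* The projection by [N K] of the solution for [r]. It satisfies the same equation with [N] in place
   of the inverse of [K], since [N L] and [N L'] do not see the difference. *)
pose y' := vec (N *m K *m Y *m Z).
have y'E : y' = N1 *m (K1 *m y).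
  by rewrite yE /K1 /N1 !tens_vec !trmx1 !mulmx1 !mulmxA.
have NL : N1 *m (L *m y') = N1 *m (L *m y).
  rewrite !mulmxA tens_mul_sum yE !sum_tens_vec; congr vec; apply: eq_bigr => j _.
  by rewrite !mulmxA NBY.
have NLh : N1 *m (L^h *m y') = N1 *m (L^h *m y).
  rewrite !mulmxA -Lambda_adjE tens_mul_sum yE !sum_tens_vec; congr vec; apply: eq_bigr => j _.
  by rewrite !mulmxA NBhY.
have eqy : y' = N1 *m (ampl c n *m v) + N1 *m (L *m y') + N1 *m (L^h *m y').
  rewrite NL NLh -e /sym_pencil Lambda_adjE !mulmxBl !mulmxBr -y'E.
  by rewrite [RHS]addrAC !subrK.
have quad (T V : 'I_g -> 'M[C]_d) (F : 'M[C]_d) (XT XV : mxtuple R g n) :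
    (forall j k, N *m T j *m N *m V k *m N = N *m T j *m N *m F^h *m (F *m N *m V k *m N)) ->
    N1 *m ((\sum_j T j *t XT j) *m (N1 *m (((F^h *m F *m N) *t 1%:M) *m
       ((\sum_k V k *t XV k) *m y')))) =
    N1 *m ((\sum_j T j *t XT j) *m (N1 *m ((\sum_k V k *t XV k) *m y'))).
  by move=> hF; rewrite y'E; exact: tens_quad.
have LE : L = \sum_j B j *t X j by [].
have LhE : L^h = \sum_j (B j)^h *t (X j)^h by rewrite -Lambda_adjE.
(* The contributions of [L] and [L'] to [y']. [F1 U1] and [F2 U2] will be the coordinates [u] and
   [w] of the solution for the model. *)
have [U1 U1E] : exists U : 'M_(d, n), vec U = N1 *m (L *m y').
  by exists (unvec (N1 *m (L *m y'))); rewrite unvecK.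
have [U2 U2E] : exists U : 'M_(d, n), vec U = N1 *m (L^h *m y').
  by exists (unvec (N1 *m (L^h *m y'))); rewrite unvecK.
have qE k : map_eval q X k = (ampl (col (mxtens_unindex k).1 al) n)^h *m hat_op N B X
    *m ampl (col (mxtens_unindex k).2 be) n := an_eval_comp (uq k).
have hatE : hat_op N B X = invmx (1%:M - N1 *m L) *m N1 - N1 by [].
have {}uM : 1%:M - N1 *m L \in unitmx := uM.
have hN1 : N1^h = N1 by rewrite /N1 adj_tens adj1 hN.
have FFN (F : 'M[C]_d) (U : 'M_(d, n)) w : vec U = N1 *m w ->
    vec (F^h *m (F *m U)) = ((F^h *m F *m N) *t 1%:M) *m w.
  move=> hU; have := tens_vec (F^h *m F) (1%:M : 'M_n) U.
  by rewrite trmx1 mulmx1 -[X in _ = vec X]mulmxA => <-; rewrite hU mulmxA tensmx_mul mulmx1.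
have es2 : N1 *m (L *m (N1 *m (ampl c n *m v + vec (F2^h *m (F2 *m U2))))) =
    N1 *m (L *m (N1 *m (ampl c n *m v + L^h *m y'))).
  by apply: mulmx_add3; rewrite (FFN _ _ _ U2E) LhE; apply: quad h2.
have es1 : N1 *m (L^h *m (N1 *m (ampl c n *m v + vec (F1^h *m (F1 *m U1))))) =
    N1 *m (L^h *m (N1 *m (ampl c n *m v + L *m y'))).
  by apply: mulmx_add3; rewrite (FFN _ _ _ U1E) LhE LE; apply: quad h1.
have actP : act (map_eval q X) (col_mx v^T (F2 *m U2)) = al^h *m U1.
  rewrite /act big_mxtens.
  under eq_bigr => a _ do under eq_bigr => b _ do rewrite qE mxtens_indexK.
  rewrite act_sandwich /be mul_row_col vecD -amplM -[U1]vecK U1E; congr (_ *m unvec _).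
  rewrite hatE; apply: (hat_solve uM _ es2).
  by rewrite mulmxDr addrAC -eqy.
have actQ : act_adj (map_eval q X) (col_mx v^T (F1 *m U1)) = be^h *m U2.
  rewrite /act_adj big_mxtens exchange_big.
  under eq_bigr => a _ do under eq_bigr => b _ do
    rewrite qE mxtens_indexK !adjM adjK mulmxA /=.
  rewrite act_sandwich /al mul_row_col vecD -amplM -[U2]vecK U2E; congr (_ *m unvec _).
  have -> : (hat_op N B X)^h = N1 *m invmx (1%:M - L^h *m N1) - N1.
    by rewrite hatE adjB adjM adj_inv adjB adjM adj1 hN1.
  apply: (hat_adj_solve _ _ es1).
    by have := uM; rewrite -adj_unit adjB adjM adj1 hN1.
  by rewrite mulmxDr -eqy.
have eqU : N *m K *m Y *m Z = N *m c *m v^T + U1 + U2.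
  apply: (@vec_inj R); rewrite !vecD U1E U2E -/y' {1}eqy; congr (_ + _ + _).
  by rewrite amplM tens_vec trmx1 mulmx1 mulmxA.
have er : sym_eval r X *m v = (c^h *m (Y *m Z))^T.
  by apply: (sym_evalE uX); rewrite -yE.
(* Dictated by the second row of the model pencil, which determines the coordinate [l]. *)
pose lam := kap%:C *: v^T + c^h *m U2 + c^h *m U1.
pose xi := col_mx (col_mx lam v^T) (col_mx (F1 *m U1) (F2 *m U2)).
have ef : sym_eval f (map_eval q X) *m v = ((model_c kap d)^h *m xi)^T.
  apply: (sym_evalE uf).
  rewrite pencil_mxE pencil_mx_modelE actP actQ amplM model_c_mul /al /be !adj_row_mx !adjK !mul_col_mx.
  by rewrite !col_mxKu !col_mxKd !subrr /lam addrK addrK.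
apply: (etrans er); apply: (etrans _ (esym ef)); congr (_^T).
rewrite /xi /model_c !adj_col_mx !mul_row_col adj0 mul0mx addr0 adj1 mul1mx adj_scalar mul_scalar_mx.
rewrite (mulmxA _ Y Z) -cY -2!(mulmxA (c^h)) -(mulmxA (c^h)) eqU !mulmxDr.
have -> : c^h *m (N *m c *m v^T) = (kap%:C + kap%:C) *: v^T.
  rewrite !mulmxA (_ : c^h *m N *m c = z%:M); last by rewrite [LHS]mx11_scalar.
  by rewrite mul_scalar_mx zE rmorphD.
rewrite /lam scalerDl -!addrA; congr (_ + _); rewrite addrC -!addrA addrCA.
by rewrite addrA addrC addrA.
Qed.

End Forward.

(** * Asymptotics in a small parameter *)

Section Asymptotics.
Variable R : realType.
Local Notation C := R[i].
Local Notation normc := (@ComplexField.Normc.normc R).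

Definition for_small (P : R -> Prop) := exists2 s0 : R, 0 < s0 & forall s, 0 < s -> s < s0 -> P s.

Lemma for_small_and P Q : for_small P -> for_small Q -> for_small (fun s => P s /\ Q s).
Proof.
move=> [a a0 ha] [b b0 hb]; exists (Num.min a b); first by rewrite lt_min a0.
by move=> s s0; rewrite lt_min => /andP[sa sb]; split; [exact: ha | exact: hb].
Qed.

Lemma for_small_imp (P Q : R -> Prop) : (forall s, 0 < s -> P s -> Q s) -> for_small P -> for_small Q.
Proof. by move=> h [a a0 ha]; exists a => // s s0 sa; apply: h => //; exact: ha. Qed.

Lemma for_small_lt (a : R) : 0 < a -> for_small (fun s => s < a).
Proof. by move=> a0; exists a. Qed.

Lemma for_small_all (I : finType) (P : I -> R -> Prop) :
  (forall i, for_small (P i)) -> for_small (fun s => forall i, P i s).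
Proof.
move=> h; have /choice[t ht] : forall i, exists t : R, 0 < t /\ forall s, 0 < s -> s < t -> P i s.
  by move=> i; have [t t0 ht] := h i; exists t.
have S0 i : 0 <= (t i)^-1 by rewrite invr_ge0 ltW //; case: (ht i).
(* Below every [t i], and positive also for an empty index type. *)
exists (\sum_i (t i)^-1 + 1)^-1; first by rewrite invr_gt0 ltr_wpDl // sumr_ge0.
move=> s s0 hs i; apply: (ht i).2 => //; apply: (lt_le_trans hs).
have ti0 := (ht i).1.
rewrite -[t i]invrK lef_pV2 ?posrE ?invr_gt0 //; last by rewrite ltr_wpDl // sumr_ge0.
by rewrite (bigD1 i) //= -addrA lerDl addr_ge0 // sumr_ge0.
Qed.

Definition isO k m n (F : R -> 'M[C]_(m, n)) :=
  exists c : R, for_small (fun s => opnorm_le (F s) (c * s ^+ k)).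

Lemma isO_ev k m n (F G : R -> 'M[C]_(m, n)) :
  for_small (fun s => F s = G s) -> isO k F -> isO k G.
Proof.
move=> h [c hc]; exists c; apply: for_small_imp (for_small_and h hc) => s _ [e]; by rewrite e.
Qed.

Lemma isO_ext k m n (F G : R -> 'M[C]_(m, n)) : F =1 G -> isO k F -> isO k G.
Proof. by move=> h; apply: isO_ev; exists 1. Qed.

Lemma isO_const m n (A : 'M[C]_(m, n)) : isO 0 (fun=> A).
Proof.
have [a ha] := opnorm_le_ex A; exists a; exists 1 => // s _ _.
by rewrite expr0 mulr1.
Qed.

Lemma isO_D k m n (F G : R -> 'M[C]_(m, n)) :
  isO k F -> isO k G -> isO k (fun s => F s + G s).
Proof.
move=> [a ha] [b hb]; exists (a + b); apply: for_small_imp (for_small_and ha hb) => s _ [h1 h2].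
by rewrite mulrDl; exact: opnorm_leD.
Qed.

Lemma isO_M k l m n p (F : R -> 'M[C]_(m, n)) (G : R -> 'M[C]_(n, p)) :
  isO k F -> isO l G -> isO (k + l) (fun s => F s *m G s).
Proof.
move=> [a ha] [b hb]; exists (a * b); apply: for_small_imp (for_small_and ha hb) => s _ [h1 h2].
by rewrite exprD mulrACA; exact: opnorm_leM.
Qed.

Lemma isO_Z k m n z (F : R -> 'M[C]_(m, n)) : isO k F -> isO k (fun s => z *: F s).
Proof.
move=> [a ha]; exists (normc z * a); apply: for_small_imp ha => s _ h.
by rewrite -mulrA; exact: opnorm_leZ.
Qed.

Lemma isO_scale k m n (F : R -> 'M[C]_(m, n)) :
  isO k F -> isO k.+1 (fun s => s%:C *: F s).
Proof.
move=> [a ha]; exists a; apply: for_small_imp ha => s s0 h.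
by rewrite exprS mulrCA; have := opnorm_leZ s%:C h; rewrite normc_real // ltW.
Qed.

Lemma isO_adj k m n (F : R -> 'M[C]_(m, n)) : isO k F -> isO k (fun s => (F s)^h).
Proof.
by move=> [a ha]; exists a; apply: for_small_imp ha => s _ h; exact: opnorm_le_adj.
Qed.

Lemma isO_le k l m n (F : R -> 'M[C]_(m, n)) : (l <= k)%N -> isO k F -> isO l F.
Proof.
move=> lk [a ha]; exists a; apply: for_small_imp (for_small_and (for_small_lt ltr01) ha) => s s0 [s1 h].
apply: (opnorm_le_le h); have := opnorm_le_ge0 h; rewrite pmulr_lge0 ?exprn_gt0 // => a0.
by rewrite ler_wpM2l // ler_wiXn2l // ltW.
Qed.

Lemma isO_sum k m n (I : finType) (F : I -> R -> 'M[C]_(m, n)) :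
  (forall i, isO k (F i)) -> isO k (fun s => \sum_i F i s).
Proof.
move=> /choice[c hc]; exists (\sum_i c i); apply: for_small_imp (for_small_all hc) => s _ h.
by rewrite mulr_suml; exact: opnorm_le_sum.
Qed.

Lemma isO_Lambda k g d n (B : mxtuple R g d) (F : R -> mxtuple R g n) :
  (forall j, isO k (fun s => F s j)) -> isO k (fun s => Lambda B (F s)).
Proof.
move=> h; apply: isO_sum => j; have [b hb] := opnorm_le_ex (B j); have [c hc] := h j.
exists (b * c); apply: for_small_imp hc => s _ hs; rewrite -mulrA; exact: opnorm_le_tens.
Qed.

Lemma isO_inv n (P : 'M[C]_n) (E : R -> 'M[C]_n) : P \in unitmx -> isO 1 E ->
  isO 0 (fun s => invmx (P - E s)) /\ for_small (fun s => P - E s \in unitmx).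
Proof.
move=> uP [c hc]; have [b hb] := opnorm_le_ex (invmx P); have b0 := opnorm_le_ge0 hb.
have key : for_small (fun s => P - E s \in unitmx /\ opnorm_le (invmx (P - E s)) (2 * b)).
  have t0 : 0 < (2 * (b * `|c| + 1))^-1.
    by rewrite invr_gt0 mulr_gt0 // ltr_wpDl // mulr_ge0.
  apply: for_small_imp (for_small_and (for_small_lt t0) hc) => s s0 [st h]; rewrite expr1 in h.
  have le : b * (c * s) <= b * `|c| * s.
    by rewrite -mulrA ler_wpM2l // ler_wpM2r ?ler_norm // ltW.
  have lt : s * (2 * (b * `|c| + 1)) < 1.
    by rewrite -ltr_pdivlMr ?div1r // mulr_gt0 // ltr_wpDl // mulr_ge0.
  apply: (opnorm_le_perturb uP hb h); apply: le_trans le _.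
  by move: (b * `|c|) lt => x lt; nra.
split; last by apply: for_small_imp key => s _ [].
by exists (2 * b); apply: for_small_imp key => s _ [_]; rewrite expr0 mulr1.
Qed.

(** [E = D + D N E], used three times; the remainder is exact, so no convergence is involved. *)
Lemma resolvent3 n (P N : 'M[C]_n) : P \in unitmx -> P - N \in unitmx ->
  let D := invmx P in let E := invmx (P - N) in
  E = D + (D *m N) *m D + (D *m N) *m (D *m N) *m D
      + (D *m N) *m (D *m N) *m (D *m N) *m E.
Proof.
move=> uP uE D E; have e : E = D + D *m N *m E.
  have h : P *m E = 1%:M + N *m E.
    by rewrite -[P in LHS](subrK N) mulmxDl [_ *m E]mulmxV.
  apply: (can_inj (mulKmx uP)); rewrite h mulmxDr -!mulmxA [P *m (D *m _)]mulKVmx //.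
  by rewrite [P *m D]mulmxV.
move: D E e {uP uE} => D E e.
move: (D *m N) e => T e.
have e2 : E = D + T *m D + T *m T *m E by rewrite {1}e {1}e mulmxDr mulmxA addrA.
rewrite {1}e2 [in X in _ + X]e.
rewrite [_ *m (D + _)]mulmxDr.
rewrite (mulmxA (T *m T) T E).
exact: addrA.
Qed.

Lemma ampl_opnorm_le d (c : 'cV[C]_d) : exists2 b : R, 0 < b & forall n, opnorm_le (ampl c n) b.
Proof.
have [b hb] := opnorm_le_ex c; exists (b + 1); first by rewrite ltr_wpDl // (opnorm_le_ge0 hb).
move=> n; apply: (@opnorm_le_le _ _ _ _ b); last by rewrite lerDl.
split=> [|v]; first exact: opnorm_le_ge0 hb.
have -> : ampl c n *m v = (c *t 1%:M) *m vec v^T.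
  by rewrite amplM tens_vec trmx1 mulmx1.
have -> : nrm v = nrm (vec v^T).
  by rewrite /nrm dotv_vec_row big_ord1 -tr_col trmxK col_id.
exact: (opnorm_le_tensl n hb).2.
Qed.

Lemma ampl_mid d (J : 'M[C]_d) (b c : 'cV[C]_d) n :
  (ampl c n)^h *m (J *t 1%:M) *m ampl b n = ((c^h *m J *m b) 0 0)%:M.
Proof.
apply: mulmx_ext => v; rewrite -!mulmxA amplM tens_vec trmx1 mulmx1 ampl_adj.
rewrite !mulmxA [X in (X *m _)^T]mx11_scalar mul_scalar_mx linearZ /= trmxK.
by rewrite mul_scalar_mx.
Qed.

Definition an_value g (a : an_realization R g) : C :=
  ((an_c a)^h *m invmx (an_J a) *m an_b a) 0 0.

Lemma an_at0 g (a : an_realization R g) :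
  an_eval a (fun _ : 'I_g => 0 : 'M[C]_1) = (an_value a)%:M.
Proof.
rewrite /an_eval -/(adj _) /an_pencil /Lambda big1 ?subr0 => [|j _]; last by rewrite tensmx0.
by rewrite (tens1_invE 1 (an_J_unit a)) ampl_mid.
Qed.

(** By the resolvent identity between [X] and 0, the value at [X] differs from that at 0 by a
    multiple of [s], uniformly in [n]. *)
Lemma an_near0_value g (a : an_realization R g) (de : R) : 0 < de ->
  for_small (fun t => forall n (X : mxtuple R g n), (forall j, opnorm_le (X j) t) ->
    an_dom a X /\ opnorm_le (an_eval a X) (normc (an_value a) + de)).
Proof.
move=> de0; have [t [b [t0 b0 ht]]] := an_near0 a.
have [b' [b'0 hb']] := opnorm_le_inv1 (an_J_unit a).
have [l l0 hl] := opnorm_le_Lambda (an_A a).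
have [x x0 hx] := ampl_opnorm_le (an_c a); have [y y0 hy] := ampl_opnorm_le (an_b a).
have w0 : 0 < x * (b * l * b') * y by rewrite !mulr_gt0.
apply: for_small_imp (for_small_and (for_small_lt t0) (for_small_lt (divr_gt0 de0 w0))) => s s0 [st sw] n X hX.
have [uX bX] : an_dom a X /\ opnorm_le (invmx (an_pencil a X)) b.
  by apply: ht => j; apply: opnorm_le_le (hX j) (ltW st).
split=> //.
have -> : an_eval a X = (an_value a)%:M +
    (ampl (an_c a) n)^h *m (invmx (an_pencil a X) *m Lambda (an_A a) X
       *m invmx (an_J a *t 1%:M)) *m ampl (an_b a) n.
  rewrite -ampl_mid -tens1_invE ?an_J_unit // -mulmxDl -mulmxDr; congr (_ *m _ *m _).
  apply: (can_inj (mulKmx uX)); rewrite mulmxDr -!mulmxA !mulKVmx // mulmxV //.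
  by rewrite /an_pencil mulmxBl subrK mulmxV // tens1_unit // an_J_unit.
apply: opnorm_leD; first by rewrite -scalemx1 -[normc _]mulr1; apply: opnorm_leZ; exact: opnorm_le1.
apply: (@opnorm_le_le _ _ _ _ (x * (b * (l * s) * b') * y)).
  apply: opnorm_leM (hy n); apply: opnorm_leM; first exact: opnorm_le_adj (hx n).
  apply: opnorm_leM (hb' n); apply: opnorm_leM bX _; apply: hl hX; exact: ltW.
move: sw; rewrite ltr_pdivlMr // => sw; apply: ltW; apply: le_lt_trans sw.
by rewrite le_eqVlt; apply/orP; left; apply/eqP; ring.
Qed.

Lemma sum_sqr_perturb h (l : 'I_h -> R) eps : (forall i, 0 <= l i) ->
  \sum_i l i ^+ 2 < eps -> exists2 de, 0 < de & \sum_i (l i + de) ^+ 2 < eps.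
Proof.
move=> l0 hl; pose S := \sum_i (2 * l i + 1).
have S0 : 0 <= S by apply: sumr_ge0 => i _; rewrite addr_ge0 // mulr_ge0.
pose ga := eps - \sum_i l i ^+ 2; have ga0 : 0 < ga by rewrite subr_gt0.
pose de := Num.min 1 (ga / (S + 1)).
have S1 : 0 < S + 1 by rewrite ltr_wpDl.
have de0 : 0 < de by rewrite lt_min ltr01 divr_gt0.
exists de => //; apply: (@le_lt_trans _ _ (\sum_i l i ^+ 2 + de * S)).
  rewrite mulr_sumr -big_split; apply: ler_sum => i _ /=.
  have : de <= 1 by rewrite ge_min lexx.
  by have := l0 i; nra.
have : de * (S + 1) <= ga by rewrite -ler_pdivlMr // ge_min lexx orbT.
by rewrite /ga; move: (\sum_i l i ^+ 2) => a; lra.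
Qed.

End Asymptotics.

Section Expansion.
Variable R : realType.
Local Notation C := R[i].
Local Notation normc := (@ComplexField.Normc.normc R).

Lemma isO_resolvent n (P : 'M[C]_n) (E : R -> 'M[C]_n) k : (0 < k)%N ->
  P \in unitmx -> isO k E -> isO k (fun s => invmx (P - E s) - invmx P).
Proof.
move=> k0 uP hE; have [hI uE] := isO_inv uP (isO_le k0 hE).
apply: (isO_ev (F := fun s => invmx P *m E s *m invmx (P - E s))); last first.
  rewrite -[k]add0n -[(0 + k)%N]addn0; apply: isO_M hI; apply: isO_M hE; exact: isO_const.
apply: for_small_imp uE => s _ u; apply: (can_inj (mulKmx uP)).
rewrite mulmxBr mulmxV // -!mulmxA mulKVmx //.
have <- : (P - E s) *m invmx (P - E s) = 1%:M by rewrite mulmxV.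
by rewrite mulmxBl subKr.
Qed.

Lemma pair_remainder n (D M E1 E2 r1 r2 : 'M[C]_n) (a : R) :
  E1 = D + (D *m (a%:C *: M)) *m D + (D *m (a%:C *: M)) *m (D *m (a%:C *: M)) *m D + r1 ->
  E2 = D + (D *m (a%:C *: - M)) *m D
       + (D *m (a%:C *: - M)) *m (D *m (a%:C *: - M)) *m D + r2 ->
  r1 + r2 = E1 + E2 - 2%:R *: D - (2%:R * (a ^+ 2)%:C) *: (D *m M *m (D *m M) *m D).
Proof.
have -> : (a ^+ 2)%:C = a%:C * a%:C by rewrite expr2 rmorphM.
have e (z : C) : D *m (z *: M) = z *: (D *m M) by rewrite -scalemxAr.
rewrite scalerN -scaleNr !e.
have e2 (z : C) : z *: (D *m M) *m D = z *: (D *m M *m D) by rewrite -scalemxAl.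
have e3 (z : C) : z *: (D *m M) *m (z *: (D *m M)) *m D = (z * z) *: (D *m M *m (D *m M) *m D).
  by rewrite -scalemxAr -!scalemxAl scalerA.
rewrite !e2 !e3; move: (D *m M *m D) (D *m M *m _ *m D) => A B -> ->.
by apply/matrixP => i j; rewrite !mxE; ring.
Qed.

Lemma isO_resolvent_pair n (P M : 'M[C]_n) : P \in unitmx ->
  let D := invmx P in
  isO 3 (fun s => invmx (P - s%:C *: M) + invmx (P - s%:C *: - M) -
                 2%:R *: D - (2%:R * (s ^+ 2)%:C) *: (D *m M *m (D *m M) *m D)).
Proof.
move=> uP D.
have hN (A : 'M[C]_n) : isO 1 (fun s => s%:C *: A) by apply: isO_scale; exact: isO_const.
have rem (A : 'M[C]_n) : isO 3 (fun s => (D *m (s%:C *: A)) *m (D *m (s%:C *: A))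
     *m (D *m (s%:C *: A)) *m invmx (P - s%:C *: A)).
  have hD : isO 1 (fun s => D *m (s%:C *: A)) := isO_M (isO_const D) (hN A).
  exact: isO_M (isO_M (isO_M hD hD) hD) (isO_inv uP (hN A)).1.
apply: isO_ev (isO_D (rem M) (rem (- M))).
apply: for_small_imp (for_small_and (isO_inv uP (hN M)).2 (isO_inv uP (hN (- M))).2) => s _ [u1 u2].
exact: pair_remainder (resolvent3 uP u1) (resolvent3 uP u2).
Qed.

Definition shift g n (X H : mxtuple R g n) (w : C) : mxtuple R g n :=
  fun j => X j + w *: H j.

Definition four_roots (u w : C) :=
  [/\ u * u = 1, u^*%C = u, w * w = -1 & w^*%C = - w].

Lemma four_roots_1i : four_roots 1 (Complex 0 1).
Proof.
split; rewrite ?mulr1 ?conjc1 //; first by rewrite -expr2; exact: sqr_i.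
by apply/eqP; rewrite eq_complex /= oppr0 !eqxx.
Qed.

Definition four (u w : C) n (F : C -> 'M[C]_n) : 'M[C]_n :=
  F u + F (- u) + (F w + F (- w)).

Lemma Lambda_shift g d n (B : mxtuple R g d) (X H : mxtuple R g n) w :
  Lambda B (shift X H w) = Lambda B X + w *: Lambda B H.
Proof.
rewrite /Lambda scaler_sumr -big_split; apply: eq_bigr => j _ /=.
by apply/matrixP => a b; rewrite !mxE; ring.
Qed.

Definition sym_dir g (r : sym_realization R g) n (H : mxtuple R g n) (w : C) :=
  w *: Lambda (sym_B r) H + w^*%C *: (Lambda (sym_B r) H)^h.

Lemma sym_pencil_shift g (r : sym_realization R g) n (X H : mxtuple R g n) (s : R) w :
  sym_pencil r (shift X H (s%:C * w)) = sym_pencil r X - s%:C *: sym_dir r H w.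
Proof.
rewrite /sym_pencil !Lambda_adjE Lambda_shift adjD adjZ.
have -> : Num.conj (s%:C * w) = s%:C * w^*%C.
  by rewrite rmorphM; congr (_ * _); exact: conjc_real.
rewrite /sym_dir scalerDr !scalerA.
move: (_ *t _) (Lambda _ X) (_ *: Lambda _ H) (_^h) (_ *: _^h) => K L W L' W'.
by apply/matrixP => i j; rewrite !mxE; ring.
Qed.

Lemma an_pencil_shift g (q : an_realization R g) n (X H : mxtuple R g n) (s : R) w :
  an_pencil q (shift X H (s%:C * w)) =
  an_pencil q X - s%:C *: (w *: Lambda (an_A q) H).
Proof. by rewrite /an_pencil Lambda_shift scalerA opprD addrA. Qed.

Lemma isO_pair_sandwich m n (P M : 'M[C]_n) (A : 'M[C]_(m, n)) (B : 'M[C]_(n, m)) :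
  P \in unitmx ->
  isO 3 (fun s => A *m invmx (P - s%:C *: M) *m B + A *m invmx (P - s%:C *: - M) *m B -
     2%:R *: (A *m invmx P *m B) -
     (2%:R * (s ^+ 2)%:C) *: (A *m (invmx P *m M *m (invmx P *m M) *m invmx P) *m B)).
Proof.
move=> uP; have h := isO_M (isO_M (isO_const A) (isO_resolvent_pair M uP)) (isO_const B).
apply: isO_ext h => s; rewrite !mulmxBr !mulmxBl mulmxDr mulmxDl.
by rewrite -!scalemxAr -!scalemxAl.
Qed.

Lemma sym_dirN g (r : sym_realization R g) n (H : mxtuple R g n) w :
  sym_dir r H (- w) = - sym_dir r H w.
Proof. by rewrite /sym_dir rmorphN !scaleNr opprD. Qed.

Lemma four_remainder n (x1 x2 x3 x4 e q1 q2 h : 'M[C]_n) (z : C) : 2%:R *: h = q1 + q2 ->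
  x1 + x2 - 2%:R *: e - (2%:R * z) *: q1 + (x3 + x4 - 2%:R *: e - (2%:R * z) *: q2) =
  x1 + x2 + (x3 + x4) - 4%:R *: e - (4%:R * z) *: h.
Proof.
move=> eh; have -> : (4%:R * z) *: h = (2%:R * z) *: (q1 + q2).
  by rewrite -eh scalerA; congr (_ *: _); ring.
by apply/matrixP => i j; rewrite !mxE; ring.
Qed.

Lemma dir_quad n (D L L' : 'M[C]_n) (w z : C) :
  (w *: L + z *: L') *m D *m (w *: L + z *: L') =
  (w * w) *: (L *m D *m L) + (w * z) *: (L *m D *m L' + L' *m D *m L)
  + (z * z) *: (L' *m D *m L').
Proof.
have e a b (M M' : 'M[C]_n) : (a *: M) *m D *m (b *: M') = (a * b) *: (M *m D *m M').
  by rewrite -scalemxAr -!scalemxAl scalerA mulrC.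
rewrite mulmxDl mulmxDr 2!mulmxDl !e.
move: (L *m D *m L) (L *m D *m L') (L' *m D *m L) (L' *m D *m L') => a b c x.
by apply/matrixP => i j; rewrite !mxE; ring.
Qed.

Lemma hessian_algebra m n (A : 'M[C]_(m, n)) (B : 'M[C]_(n, m)) (D L L' : 'M[C]_n) u w0 :
  four_roots u w0 -> let M w := w *: L + w^*%C *: L' in
  2%:R *: (A *m D *m L' *m D *m L *m D *m B + A *m D *m L *m D *m L' *m D *m B) =
    A *m (D *m M u *m (D *m M u) *m D) *m B +
    A *m (D *m M w0 *m (D *m M w0) *m D) *m B.
Proof.
move=> [uu cu ii ci] M.
have dist b c : A *m (D *m (b + c) *m D) *m B =
    A *m (D *m b *m D) *m B + A *m (D *m c *m D) *m B.
  by rewrite mulmxDr mulmxDl mulmxDr mulmxDl.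
have quad w : D *m M w *m (D *m M w) *m D = D *m (M w *m D *m M w) *m D by rewrite !mulmxA.
have -> : A *m D *m L' *m D *m L *m D *m B + A *m D *m L *m D *m L' *m D *m B =
    A *m (D *m (L *m D *m L' + L' *m D *m L) *m D) *m B.
  by rewrite dist addrC !mulmxA.
have sum : M u *m D *m M u + M w0 *m D *m M w0 =
    2%:R *: (L *m D *m L' + L' *m D *m L).
  rewrite (dir_quad D L L' u) (dir_quad D L L' w0) cu ci mulrNN mulrN ii uu opprK.
  move: (L *m D *m L) (L *m D *m L' + L' *m D *m L) (L' *m D *m L') => a b c.
  by apply/matrixP => i j; rewrite !mxE; ring.
rewrite (quad u) (quad w0); apply: etrans (dist _ _); rewrite sum.
move: (L *m D *m L' + _) => x.
by rewrite -!scalemxAr -!scalemxAl -scalemxAr -scalemxAl.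
Qed.

Lemma hessian_dir g (r : sym_realization R g) n (X H : mxtuple R g n) u w :
  four_roots u w ->
  let D := sym_Delta r X in let A := (ampl (sym_c r) n)^h in let B := ampl (sym_c r) n in
  2%:R *: complex_hessian r X H =
    A *m (D *m sym_dir r H u *m (D *m sym_dir r H u) *m D) *m B +
    A *m (D *m sym_dir r H w *m (D *m sym_dir r H w) *m D) *m B.
Proof.
move=> uw D A B; rewrite /complex_hessian Lambda_adjE; exact: hessian_algebra uw.
Qed.

Lemma sym_four g (r : sym_realization R g) n (X H : mxtuple R g n) u w :
  four_roots u w -> sym_dom r X ->
  isO 3 (fun s => four u w (fun w => sym_eval r (shift X H (s%:C * w))) -
     4%:R *: sym_eval r X - (4%:R * (s ^+ 2)%:C) *: complex_hessian r X H).
Proof.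
move=> uw uX; pose A := (ampl (sym_c r) n)^h; pose B := ampl (sym_c r) n.
have h1 := isO_pair_sandwich (sym_dir r H u) A B uX.
have h2 := isO_pair_sandwich (sym_dir r H w) A B uX.
have evalE s z : sym_eval r (shift X H (s%:C * z)) =
    A *m invmx (sym_pencil r X - s%:C *: sym_dir r H z) *m B.
  by rewrite /sym_eval /sym_Delta sym_pencil_shift.
apply: isO_ext (isO_D h1 h2) => s.
rewrite /four (evalE s u) (evalE s (- u)) (evalE s w) (evalE s (- w)).
rewrite (sym_dirN r H u) (sym_dirN r H w).
exact: four_remainder (hessian_dir r X H uw).
Qed.

Lemma an_four g (q : an_realization R g) n (X H : mxtuple R g n) u w :
  four_roots u w -> an_dom q X ->
  isO 3 (fun s => four u w (fun w => an_eval q (shift X H (s%:C * w))) - 4%:R *: an_eval q X).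
Proof.
move=> [uu _ ii _] uX; pose A := (ampl (an_c q) n)^h; pose B := ampl (an_b q) n.
pose L := Lambda (an_A q) H.
have h1 := isO_pair_sandwich (u *: L) A B uX.
have h2 := isO_pair_sandwich (w *: L) A B uX.
have evalE s z : an_eval q (shift X H (s%:C * z)) =
    A *m invmx (an_pencil q X - s%:C *: (z *: L)) *m B.
  by rewrite /an_eval an_pencil_shift.
apply: isO_ext (isO_D h1 h2) => s.
rewrite /four (evalE s u) (evalE s (- u)) (evalE s w) (evalE s (- w)).
rewrite (scaleNr u L) (scaleNr w L).
have cancel D : 2%:R *: (0 : 'M[C]_n) =
    A *m (D *m (u *: L) *m (D *m (u *: L)) *m D) *m B +
    A *m (D *m (w *: L) *m (D *m (w *: L)) *m D) *m B.
  have e (z : C) : D *m (z *: L) *m (D *m (z *: L)) *m D = (z * z) *: (D *m L *m (D *m L) *m D).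
    by rewrite -!scalemxAr -!scalemxAl scalerA.
  rewrite (e u) (e w) ii uu scaleN1r scale1r mulmxN mulNmx scaler0.
  by rewrite subrr.
by apply: etrans (four_remainder _ _ _ _ _ _ (cancel _)) _; rewrite scaler0 subr0.
Qed.

Lemma sym_eval_isO g (f : sym_realization R g) n (Y : mxtuple R g n)
    (Z : R -> mxtuple R g n) k : (0 < k)%N -> sym_dom f Y ->
  (forall i, isO k (fun s => Z s i - Y i)) ->
  isO k (fun s => sym_eval f (Z s) - sym_eval f Y).
Proof.
move=> k0 uY hZ; pose E s : 'M[C]_(sym_size f * n) :=
  Lambda (sym_B f) (fun i => Z s i - Y i) + (Lambda (sym_B f) (fun i => Z s i - Y i))^h.
have hE : isO k E by apply: isO_D; [| apply: isO_adj]; apply: isO_Lambda.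
have pE s : sym_pencil f (Z s) = sym_pencil f Y - E s.
  have e : Lambda (sym_B f) (Z s) =
      Lambda (sym_B f) Y + Lambda (sym_B f) (fun i => Z s i - Y i).
    rewrite /Lambda -big_split; apply: eq_bigr => j _ /=.
    by apply/matrixP => a b; rewrite !mxE; ring.
  rewrite /sym_pencil /E !Lambda_adjE e adjD.
  set K := _ *t _; set a := Lambda _ Y; set b := Lambda _ _.
  by move: K a b (a^h) (b^h) => K a b a' b'; apply/matrixP => i j; rewrite !mxE; ring.
have h := isO_M (isO_M (isO_const (ampl (sym_c f) n)^h) (isO_resolvent k0 uY hE))
   (isO_const (ampl (sym_c f) n)).
rewrite add0n addn0 in h; apply: isO_ext h => s.
by rewrite mulmxBr mulmxBl -pE.
Qed.

End Expansion.

(** * From convex composition to plush *)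

Section Backward.
Variable R : realType.
Local Notation C := R[i].
Local Notation normc := (@ComplexField.Normc.normc R).
Local Notation cRe := (@complex.Re R).

Lemma map_near0 g h (q : an_mapping R g h) eps : 0 < eps -> nc_ball eps (map_at0 q) ->
  exists2 rho : 'I_h -> R, \sum_i rho i ^+ 2 < eps ^+ 2 &
    for_small (fun t => forall n (X : mxtuple R g n), (forall j, opnorm_le (X j) t) ->
      map_dom q X /\ forall i, opnorm_le (map_eval q X i) (rho i)).
Proof.
move=> e0 hB; have h0 : \sum_i normc (an_value (q i)) ^+ 2 < eps ^+ 2.
  have d0 : (delta_mx 0 0 : 'cV[C]_1) != 0 by rewrite -nrm_eq0 nrm_delta oner_eq0.
  have := hB _ d0; rewrite nc_ballE ltcR subr_gt0 nrm_delta expr1n mulr1.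
  congr (_ < _); apply: eq_bigr => i _.
  by rewrite /map_at0 /map_eval an_at0 mul_scalar_mx nrmZ nrm_delta mulr1.
have [de de0 hde] := sum_sqr_perturb (fun i => normc_ge0 (an_value (q i))) h0.
exists (fun i => normc (an_value (q i)) + de) => //.
apply: for_small_imp (for_small_all (fun i => an_near0_value (q i) de0)) => t _ ht n X hX.
by split=> i; case: (ht i n X hX).
Qed.

Lemma shift_small g n (X H : mxtuple R g n) (t : R) z : 0 < t ->
  (forall j, opnorm_le (X j) (t / 2)) -> for_small (fun s => forall j, opnorm_le (shift X H (s%:C * z) j) t).
Proof.
move=> t0 hX; apply: for_small_all => j; have [m hm] := opnorm_le_ex (H j).
have m0 := opnorm_le_ge0 hm; pose a := normc z * m.
have a0 : 0 <= a by rewrite mulr_ge0 // normc_ge0.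
have t1 : 0 < t / 2 / (a + 1) by rewrite !divr_gt0 // ltr_wpDl.
apply: for_small_imp (for_small_lt t1) => s s0 hs.
apply: opnorm_le_le (opnorm_leD (hX j) (opnorm_leZ (s%:C * z) hm)) _.
rewrite ComplexField.Normc.normcM normc_real ?ltW // -mulrA -/a.
have : s * (a + 1) < t / 2 by rewrite -ltr_pdivlMr // ltr_wpDl.
by rewrite mulrDr mulr1; lra.
Qed.

Lemma complex_hessian_herm g (r : sym_realization R g) n (X H : mxtuple R g n) :
  (complex_hessian r X H)^h = complex_hessian r X H.
Proof.
rewrite /complex_hessian -!/(adj _) Lambda_adjE; have hD := sym_Delta_herm r X.
move: (sym_Delta r X) (ampl _ _) (Lambda _ _) hD => D A L hD.
have sandwich p (S : 'M[C]_(p, n)) (E : 'M[C]_p) : E^h = E -> (S^h *m E *m S)^h = S^h *m E *m S.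
  by move=> hE; rewrite 2!adjM adjK hE mulmxA.
have e (K : 'M[C]__) : A^h *m D *m K^h *m D *m K *m D *m A = (K *m D *m A)^h *m D *m (K *m D *m A).
  by rewrite 2!adjM hD !mulmxA.
have e1 := e L; have := e (L^h); rewrite adjK => e2.
by rewrite e1 e2 adjD; congr (_ + _); exact: sandwich.
Qed.

Lemma opnorm_le_midpoint h n (X Y : mxtuple R h n) (rho : 'I_h -> R) :
  (forall i, opnorm_le (X i) (rho i)) -> (forall i, opnorm_le (Y i) (rho i)) ->
  forall i, opnorm_le (midpoint X Y i) (rho i).
Proof.
move=> hX hY i; apply: opnorm_le_le (opnorm_leZ _ (opnorm_leD (hX i) (hY i))) _.
by rewrite half_complexE normc_real ?invr_ge0 //; lra.
Qed.

Lemma convex_four h (f : sym_realization R h) eps (rho : 'I_h -> R) n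
    (Q1 Q2 Q3 Q4 : mxtuple R h n) (E1 E2 E3 E4 : 'M[C]_n) v :
  convex_on eps f -> \sum_i rho i ^+ 2 < eps ^+ 2 ->
  (forall i, opnorm_le (Q1 i) (rho i)) -> (forall i, opnorm_le (Q2 i) (rho i)) ->
  (forall i, opnorm_le (Q3 i) (rho i)) -> (forall i, opnorm_le (Q4 i) (rho i)) ->
  sym_eval f Q1 = E1 -> sym_eval f Q2 = E2 -> sym_eval f Q3 = E3 -> sym_eval f Q4 = E4 ->
  0 <= dotv v ((E1 + E2 + (E3 + E4)
                - 4%:R *: sym_eval f (midpoint (midpoint Q1 Q2) (midpoint Q3 Q4))) *m v).
Proof.
move=> [_ cf] hrho h1 h2 h3 h4 <- <- <- <-; set M := midpoint _ _.
have inB (X : mxtuple R h n) : (forall i, opnorm_le (X i) (rho i)) -> nc_ball eps X.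
  by move=> hX; exact: opnorm_le_nc_ball hX hrho.
have h12 := opnorm_le_midpoint h1 h2; have h34 := opnorm_le_midpoint h3 h4.
have p1 := cf _ _ _ (inB _ h1) (inB _ h2) v; have p2 := cf _ _ _ (inB _ h3) (inB _ h4) v.
have p3 := cf _ _ _ (inB _ h12) (inB _ h34) v.
rewrite -mulmxA -/(dotv _ _) in p1; rewrite -mulmxA -/(dotv _ _) in p2.
rewrite -mulmxA -/(dotv _ _) in p3; rewrite -/M in p3.
move: (sym_eval f Q1) (sym_eval f Q2) (sym_eval f Q3) (sym_eval f Q4)
  (sym_eval f (midpoint Q1 Q2)) (sym_eval f (midpoint Q3 Q4)) (sym_eval f M) p1 p2 p3.
move=> F1 F2 F3 F4 G1 G2 G p1 p2 p3.
have -> : F1 + F2 + (F3 + F4) - 4%:R *: G =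
    2%:R *: (2^-1 *: (F1 + F2) - G1) + 2%:R *: (2^-1 *: (F3 + F4) - G2)
    + 4%:R *: (2^-1 *: (G1 + G2) - G).
  by apply/matrixP => i j; rewrite !mxE; field.
have key (A B D : 'M[C]_n) : 0 <= dotv v (A *m v) -> 0 <= dotv v (B *m v) ->
    0 <= dotv v (D *m v) -> 0 <= dotv v ((2%:R *: A + 2%:R *: B + 4%:R *: D) *m v).
  move=> hA hB hD; rewrite 2!mulmxDl 2!dotvDr -!scalemxAl !dotvZr.
  by apply: addr_ge0; [apply: addr_ge0|]; apply: mulr_ge0 => //; exact: ler0n.
exact: (key _ _ _ p1 p2 p3).
Qed.

Lemma second_order_bound n (S e T F : 'M[C]_n) (s c : R) v : 0 < s ->
  opnorm_le (S - 4%:R *: e - (4%:R * (s ^+ 2)%:C) *: T + (- 4%:R) *: (F - e)) (c * s ^+ 3) ->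
  0 <= dotv v ((S - 4%:R *: F) *m v) ->
  - cRe (dotv v (T *m v)) <= c * nrm v ^+ 2 / 4 * s.
Proof.
move=> s0; set E := (X in opnorm_le X _) => hE.
have -> : S - 4%:R *: F = E + (4%:R * s ^+ 2)%:C *: T.
  by rewrite rmorphM rmorph_nat /E; apply/matrixP => i j; rewrite !mxE; ring.
rewrite mulmxDl dotvDr -scalemxAl dotvZr => pos.
have : 0 <= cRe (dotv v (E *m v)) + 4%:R * s ^+ 2 * cRe (dotv v (T *m v)).
  move: pos; rewrite lecE => /andP[_]; case: (dotv v (E *m v)) => a b.
  by case: (dotv v (T *m v)) => x y /=; rewrite mul0r subr0.
have : cRe (dotv v (E *m v)) <= nrm v * (c * s ^+ 3 * nrm v).
  apply: le_trans (Re_le_normc _) _; apply: le_trans (dotv_CauchySchwarz _ _) _.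
  by rewrite ler_wpM2l ?nrm_ge0 // hE.2.
move: (cRe _) (cRe _) (nrm v) => a x m h1 h2.
have s2 : 0 < 4 * s ^+ 2 by rewrite mulr_gt0 // exprn_gt0.
rewrite -(ler_pM2l s2); move: h1 h2; rewrite !exprS !expr0; lra.
Qed.

Theorem decomposition_plush g (r : sym_realization R g) h (f : sym_realization R h)
    (q : an_mapping R g h) eps :
  0 < eps -> convex_on eps f -> nc_ball eps (map_at0 q) -> nc_comp_eq r f q -> plush r.
Proof.
move=> e0 cf hB rfq; have [rho hrho [s0 s00 hs0]] := map_near0 e0 hB.
have [t1 [b [t10 _ ht1]]] := sym_near0 r.
pose t := Num.min t1 (s0 / 2).
have t0 : 0 < t by rewrite lt_min t10 divr_gt0.
have near n (X : mxtuple R g n) : (forall j, opnorm_le (X j) t) ->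
    [/\ sym_dom r X, map_dom q X, forall i, opnorm_le (map_eval q X i) (rho i)
      & sym_eval f (map_eval q X) = sym_eval r X].
  move=> hX; have ur : sym_dom r X.
    by apply: (ht1 _ _ _).1 => j; apply: opnorm_le_le (hX j) _; rewrite ge_min lexx.
  have ts0 : t < s0.
    by rewrite gt_min ltr_pdivrMr // ltr_pMr // ltr1n orbT.
  have [uq hq] := hs0 t t0 ts0 n X hX; split=> //.
  by rewrite (rfq n X) //; apply: cf.1; exact: opnorm_le_nc_ball hq hrho.
have th0 : 0 < t / 2 by rewrite divr_gt0.
exists (t / 2) => // n X hX.
have {}hX j : opnorm_le (X j) (t / 2) by exact: nc_ball_opnorm_le (ltW th0) hX.
have hXt j : opnorm_le (X j) t by apply: opnorm_le_le (hX j) _; lra.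
have [ur uq hq fq] := near n X hXt; split=> // H; apply: psdmx_dotv => v.
apply: ge0_herm; first exact: complex_hessian_herm.
pose u : C := 1; pose w : C := Complex 0 1.
have uw : four_roots u w := four_roots_1i R.
clearbody u w.
pose Q (z : C) s := map_eval q (shift X H (s%:C * z)).
pose M s := midpoint (midpoint (Q u s) (Q (- u) s)) (midpoint (Q w s) (Q (- w) s)).
have MO i : isO 3 (fun s => M s i - map_eval q X i).
  apply: isO_ext (isO_Z (4%:R^-1) (an_four H uw (uq i))) => s.
  rewrite /M /midpoint /Q /map_eval /four.
  move: (an_eval _ _) (an_eval _ _) (an_eval _ _) (an_eval _ _) (an_eval _ _) => a1 a2 a3 a4 a5.
  by apply/matrixP => x y; rewrite !mxE; field.
have uf : sym_dom f (map_eval q X) by apply: cf.1; exact: opnorm_le_nc_ball hq hrho.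
have fO := sym_eval_isO (isT : (0 < 3)%N) uf MO.
have [c hc] := isO_D (sym_four H uw ur) (isO_Z (- 4%:R) fO).
have sh z := shift_small H z t0 hX.
have {sh} hsh := for_small_and (for_small_and (sh u) (sh (- u))) (for_small_and (sh w) (sh (- w))).
have [s1 s10 hs1] := for_small_and hc hsh.
rewrite -oppr_le0; apply: (le0_small (a := c * nrm v ^+ 2 / 4) s10) => s sp ss1.
have [hT [[su sNu] [sw sNw]]] := hs1 s sp ss1.
have [_ _ bu eu] := near _ _ su; have [_ _ bNu eNu] := near _ _ sNu.
have [_ _ bw ew] := near _ _ sw; have [_ _ bNw eNw] := near _ _ sNw.
have pos := convex_four v cf hrho bu bNu bw bNw eu eNu ew eNw.
rewrite fq in hT; exact: second_order_bound sp hT pos.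
Qed.

End Backward.

(* The point q(0) must lie in a ball on which f is convex: otherwise f o q may be
   defined nowhere, and convexity of f near 0 says nothing about f o q. Any q
   with q(0) = 0 satisfies this. *)
Theorem theorem1p3 (R : realType) (g : nat) (r : sym_realization R g) :
  plush r <->
  exists (h : nat) (f : sym_realization R h) (q : an_mapping R g h),
    [/\ (0 < h)%N,
        exists eps : R, [/\ 0 < eps, convex_on eps f & nc_ball eps (map_at0 q)]
      & nc_comp_eq r f q].
Proof.
split; first exact: plush_decomposition.
by case=> h [f [q [_ [eps [e0 cf hB]] rfq]]]; exact: decomposition_plush e0 cf hB rfq.
Qed.
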